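(* Let $k \geq 1$ be an integer and let $H$ be a graph that is the disjoint union of $k$ vertex-disjoint cycles (of arbitrary lengths). Then every finite graph $G$ that does not contain $H$ as a minor has treewidth at most \[ 6|V(H)| + 10k\log k + 10k\log\log k + 40k, \] i.e. $f(H) \leq 6|V(H)| + 10k\log k + 10k\log\log k + 40k$. Here all logarithms are base $2$, and for $k=1$ the term $10k\log\log k$ is interpreted as $0$.
   Context: For a graph $H$, $f(H)$ denotes the minimum nonnegative integer such that every graph excluding $H$ as a minor has treewidth at most $f(H)$. A cycle has length at least $3$. All graphs are finite and simple. *)

(* Defs.v *)
From HB Require Import structures.
From mathcomp Require Import all_boot all_order all_algebra.
From mathcomp Require Import boolp reals exp.

Set Implicit Arguments.
Unset Strict Implicit.
Unset Printing Implicit Defensive.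

Import Order.TTheory GRing.Theory Num.Theory.

Record sgraph := SGraph {
  vertex :> finType;
  adj : rel vertex;
  adj_sym : symmetric adj;
  adj_irrefl : irreflexive adj
}.

Definition sgraph_iso (G H : sgraph) : Prop :=
  exists f : G -> H, bijective f /\ forall x y, adj (f x) (f y) = adj x y.

(* Connectedness of the subgraph induced on [S]; holds for [S = set0]. *)
Definition connected_in (G : sgraph) (S : {set G}) : Prop :=
  {in S &, forall x y, connect [rel u v in S | adj u v] x y}.

(* [phi v] is the branch set of the vertex [v] of [H]. *)
Definition is_minor_model (H G : sgraph) (phi : H -> {set G}) : Prop :=
  [/\ forall v, phi v != set0,
      forall v, connected_in (phi v),
      forall u v, u != v -> [disjoint phi u & phi v]
    & forall u v, adj u v ->
        exists x y, [/\ x \in phi u, y \in phi v & adj x y]].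

Definition minor (H G : sgraph) : Prop :=
  exists phi : H -> {set G}, is_minor_model phi.

(* [ucycle] also accepts the sequences [::] and [:: x; y] with [adj x y],
   which are not cycles of a simple graph. *)
Definition acyclic (G : sgraph) : Prop :=
  forall p : seq G, 3 <= size p -> ~ ucycle (@adj G) p.

Definition is_tree (T : sgraph) : Prop :=
  [/\ 0 < #|T|, connected_in [set: T] & acyclic T].

Definition is_tree_decomposition (G T : sgraph) (B : T -> {set G}) : Prop :=
  [/\ is_tree T,
      forall v : G, exists t, v \in B t,
      forall u v : G, adj u v -> exists t, (u \in B t) && (v \in B t)
    & forall v : G, connected_in [set t | v \in B t]].

(* The predecessor is truncated: the graph without vertices gets width 0. *)
Definition width (G T : sgraph) (B : T -> {set G}) : nat :=
  (\max_(t : T) #|B t|).-1.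

Definition has_decomposition_of_width (G : sgraph) (w : nat) : Prop :=
  exists (T : sgraph) (B : T -> {set G}),
    is_tree_decomposition B /\ width B = w.

Lemma has_decomposition_exists (G : sgraph) :
  exists w, `[< has_decomposition_of_width G w >].
Proof.
pose T := @SGraph unit (fun _ _ => false) (fun _ _ => erefl) (fun _ => erefl).
pose B := fun _ : T => [set: G].
exists (width B); apply/asboolP; exists T, B; split=> //; split.
- split; first by apply/card_gt0P; exists tt.
  + by move=> [] [] _ _; exact: connect0.
  + by move=> [|x [|y p]] //= _ /andP[].
- by move=> v; exists tt; rewrite inE.
- by move=> u v _; exists tt; rewrite !inE.
- by move=> v [] [] _ _; exact: connect0.
Qed.

Definition treewidth (G : sgraph) : nat := ex_minn (has_decomposition_exists G).

Definition is_minor_treewidth_bound (H : sgraph) (n : nat) : Prop :=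
  forall G : sgraph, ~ minor H G -> treewidth G <= n.

(* [f(H) = n], as a relation because such an [n] need not exist for every
   [H]. *)
Definition is_f (H : sgraph) (n : nat) : Prop :=
  is_minor_treewidth_bound H n /\
  forall m, is_minor_treewidth_bound H m -> n <= m.

Section CycleGraph.
Variable n : nat.

(* [ordS] is the cyclic successor; the conjunct [i != j] only matters for
   [n = 1], where [ordS] has a fixed point. This is a cycle when [3 <= n]. *)
Definition cycle_adj : rel 'I_n :=
  fun i j => (i != j) && ((j == ordS i) || (i == ordS j)).

Lemma cycle_adj_sym : symmetric cycle_adj.
Proof. by move=> i j; rewrite /cycle_adj eq_sym orbC. Qed.

Lemma cycle_adj_irrefl : irreflexive cycle_adj.
Proof. by move=> i; rewrite /cycle_adj eqxx. Qed.

Definition cycle_graph : sgraph := SGraph cycle_adj_sym cycle_adj_irrefl.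
End CycleGraph.

Section DisjointUnion.
Variables (I : finType) (F : I -> sgraph).

(* [tagged_as u v] is [tagged v] transported to the component of [u] when
   [tag u == tag v]. *)
Definition dunion_adj : rel {i : I & F i} :=
  fun u v => (tag u == tag v) && adj (tagged u) (tagged_as u v).

Lemma dunion_adj_sym : symmetric dunion_adj.
Proof.
move=> [i x] [j y]; rewrite /dunion_adj /= eq_sym.
case: eqVneq => //= eij; move: eij x y => -> x y.
by rewrite !tagged_asE adj_sym.
Qed.

Lemma dunion_adj_irrefl : irreflexive dunion_adj.
Proof.
by move=> [i x]; rewrite /dunion_adj /= eqxx tagged_asE adj_irrefl.
Qed.

Definition dunion : sgraph := SGraph dunion_adj_sym dunion_adj_irrefl.
End DisjointUnion.

Definition is_disjoint_union_of_cycles (k : nat) (H : sgraph) : Prop :=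
  exists l : 'I_k -> nat,
    (forall i, 3 <= l i) /\ sgraph_iso H (dunion (fun i => cycle_graph (l i))).

Local Open Scope ring_scope.

Definition log2 (R : realType) (x : R) : R := ln x / ln 2.

(* The last summand [10 k log log k] is read as 0 for [k = 1]. *)
Definition cycles_bound (R : realType) (k : nat) (H : sgraph) : R :=
  6 * #|H|%:R + 10 * k%:R * log2 k%:R
  + (if k == 1%N then 0 else 10 * k%:R * log2 (log2 k%:R))
  + 40 * k%:R.

(* Main.v *)
Require Import Defs.
From mathcomp Require Import all_boot all_order all_algebra.
From mathcomp Require Import zify ring lra boolp reals exp.

(**
The cycles are found by induction on [k]. Let [l] be the largest prescribed
length. If some cycle has length between [l] and [2 l], delete it: this costs
[2 l] vertices. Otherwise every cycle is short (length [< l]) or has length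
[> 2 l]. Then two short cycles meeting in two vertices only generate short
cycles, so lying on a common short cycle is an equivalence relation on the
edges, and a cycle inside one class is short.

In this case take a maximal subgraph [h] all of whose degrees are 2 or 3 and
all of whose cycles are long. By a counting argument of Simonovits it either
contains [k] disjoint cycles or has [O(k log k)] vertices of degree 3. By
maximality, a path that leaves [h] between two vertices of degree 2 closes a
short cycle together with a path of [h]. Delete the vertices of degree 3, the
few vertices at which some long cycle touches [h], and on each remaining path
of [h] one vertex at which [h] passes from one class to another. A surviving
long cycle changes class somewhere, hence on one of these paths, and it would
have to follow this path through the deleted vertex.

What is left has only short cycles, and its treewidth is bounded by means of a
depth-first forest.
*)

Set Implicit Arguments.
Unset Strict Implicit.
Unset Printing Implicit Defensive.

(** * Cycles as sequences *)

(** A cycle of length at least [l] contracts onto one of length [l], so lengths matter only from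
    below, and a packing of cycles at least as long as the largest prescribed length serves all of
    them. The factor 2 in the gap makes the classes work: two short cycles together have fewer than
    [2 l] vertices, so a cycle in their union is never long.

    The obstacle is that a long cycle may leave [h] and return many times, while maximality says
    nothing about an excursion ending at a vertex of degree 3, which would get degree 4. Between
    vertices of degree 2, each excursion is shadowed by a path of [h] in a single class, and such a
    path cannot cross a vertex where [h] changes class.

    For [t] close to [log k + log log k], at most [5 (k-1) (2t-1) + 2 (k-1)] vertices are spent on
    the hitting set, which yields the terms [10 k log k] and [10 k log log k]. The deleted cycles
    and the last [l] cost at most [2 |V(H)|]; the other [4 |V(H)| >= 12 k] absorb rounding. *)

Section ConsecutivePairs.
Variable T : eqType.
Implicit Types (s : seq T) (x y : T).

(** Edges are relations on vertices because these, unlike sequences, do not change when a cycle is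
    rotated or reversed. *)
Fixpoint dstep s x y :=
  if s is a :: s' then
    (if s' is b :: _ then (a == x) && (b == y) else false) || dstep s' x y
  else false.

Definition step s x y := dstep s x y || dstep s y x.

Definition cstep c x y := if c is a :: c' then step (rcons c a) x y else false.

Lemma dstep_cat s1 a s2 x y :
  dstep (s1 ++ a :: s2) x y = dstep (rcons s1 a) x y || dstep (a :: s2) x y.
Proof.
elim: s1 => [|b s1 IH]; first by rewrite /=.
by rewrite cat_cons rcons_cons /= -/(dstep _ _ _) IH /= orbA; case: (s1).
Qed.

Lemma dstep_rcons2 s a b x y :
  dstep (rcons (rcons s a) b) x y = dstep (rcons s a) x y || (a == x) && (b == y).
Proof. by rewrite -cats1 cat_rcons dstep_cat /= !orbF. Qed.

Lemma dstep_rev s x y : dstep (rev s) x y = dstep s y x.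
Proof.
elim: s => [|a [|b s] IH] //.
rewrite !rev_cons dstep_rcons2 -rev_cons IH orbC [RHS]/=.
by rewrite andbC.
Qed.

Lemma stepC s x y : step s x y = step s y x.
Proof. by rewrite /step orbC. Qed.

Lemma step_rev s : step (rev s) =2 step s.
Proof. by move=> x y; rewrite /step !dstep_rev orbC. Qed.

Lemma step_cat s1 a s2 x y :
  step (s1 ++ a :: s2) x y = step (rcons s1 a) x y || step (a :: s2) x y.
Proof. by rewrite /step !(dstep_cat s1); exact: orbACA. Qed.

Lemma step_cons2 a b s x y :
  step [:: a, b & s] x y =
  [|| (a == x) && (b == y), (a == y) && (b == x) | step (b :: s) x y].
Proof.
rewrite /step /=.
by case: (a == x); case: (b == y); case: (a == y); case: (b == x); rewrite ?orbT ?orbF /= ?orbT.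
Qed.

Lemma dstep_mem s x y : dstep s x y -> (x \in s) && (y \in s).
Proof.
elim: s => [|a [|b s] IH] //= /orP[/andP[/eqP-> /eqP->]|].
  by rewrite !inE !eqxx orbT.
by move/IH => /andP[? ?]; apply/andP; split; rewrite inE; apply/orP; right.
Qed.

Lemma step_mem s x y : step s x y -> (x \in s) && (y \in s).
Proof. by case/orP=> /dstep_mem; rewrite // andbC. Qed.

Lemma dstep_path (e : rel T) a s x y : path e a s -> dstep (a :: s) x y -> e x y.
Proof.
elim: s a => [|b s IH] a //= /andP[eab pbs] /orP[/andP[/eqP<- /eqP<-]//|].
exact: IH.
Qed.

Lemma step_path (e : rel T) a s x y :
  symmetric e -> path e a s -> step (a :: s) x y -> e x y.
Proof. by move=> es ps /orP[]/(dstep_path ps); rewrite // es. Qed.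

Lemma dstep_split s x y : dstep s x y -> exists s1 s2, s = s1 ++ [:: x, y & s2].
Proof.
elim: s => [|a [|b s] IH] //= /orP[/andP[/eqP-> /eqP->]|]; first by exists [::], s.
by case/IH=> s1 [s2 ->]; exists (a :: s1), s2.
Qed.

Lemma cstepC c x y : cstep c x y = cstep c y x.
Proof. by case: c => //= a c; rewrite stepC. Qed.

(** The two arcs between [x] and [y]: the form in which cycles are cut and glued below. *)
Lemma cstep_split x r1 y r2 :
  cstep (x :: r1 ++ y :: r2) =2
  fun a b => step (x :: rcons r1 y) a b || step (y :: rcons r2 x) a b.
Proof. by move=> a b; rewrite /cstep -cat_cons rcons_cat rcons_cons step_cat. Qed.

Lemma cstep_catC s1 s2 : cstep (s1 ++ s2) =2 cstep (s2 ++ s1).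
Proof.
case: s1 => [|a s1]; first by rewrite cats0.
case: s2 => [|b s2]; first by rewrite cats0.
by move=> x y; rewrite !cat_cons !cstep_split orbC.
Qed.

Lemma cstep_rot n c : cstep (rot n c) =2 cstep c.
Proof. by move=> x y; rewrite /rot cstep_catC cat_take_drop. Qed.

Lemma cstep_rev c : cstep (rev c) =2 cstep c.
Proof.
move=> x y; case: c => // a c.
rewrite rev_cons -cats1 cstep_catC /= -rev_cons -(rev_rcons (a :: c) a).
by rewrite step_rev.
Qed.

Lemma cstep_mem c x y : cstep c x y -> (x \in c) && (y \in c).
Proof.
case: c => // a c /step_mem; rewrite rcons_cons !(inE, mem_rcons).
by case/andP=> /or3P[->|->|->] /or3P[->|->|->]; rewrite ?orbT.
Qed.

End ConsecutivePairs.

Section Cycles.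
Variables (V : finType) (g : rel V).
Hypotheses (gS : symmetric g) (gI : irreflexive g).
Implicit Types (c s : seq V) (x y : V).

Definition is_cyc c := [&& 2 < size c, cycle g c & uniq c].

Lemma is_cyc_rot n c : is_cyc (rot n c) = is_cyc c.
Proof. by rewrite /is_cyc size_rot rot_cycle rot_uniq. Qed.

Lemma is_cyc_catC s1 s2 : is_cyc (s1 ++ s2) = is_cyc (s2 ++ s1).
Proof. by rewrite -(is_cyc_rot (size s1)) rot_size_cat. Qed.

Lemma path_revS x s y : path g x (rcons s y) = path g y (rcons (rev s) x).
Proof.
have := rev_path g x (rcons s y); rewrite last_rcons belast_rcons rev_cons => ->.
by apply: eq_path => a b; rewrite gS.
Qed.

Lemma is_cyc_rev c : is_cyc (rev c) = is_cyc c.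
Proof.
rewrite /is_cyc size_rev rev_uniq rev_cycle.
by congr [&& _, _ & _]; apply: eq_cycle => a b; rewrite gS.
Qed.

Lemma is_cyc_step c x y : is_cyc c -> cstep c x y -> g x y.
Proof.
by case/and3P => _; case: c => //= a c pc _; apply: step_path pc.
Qed.

Lemma is_cyc_rev_at x s : is_cyc (x :: s) -> is_cyc (x :: rev s).
Proof. by rewrite -is_cyc_rev rev_cons -cats1 is_cyc_catC. Qed.

(** Equality up to starting point and direction, recorded by invariants so that no rotation has to
    be carried along. *)
Definition same_cyc c d := [/\ is_cyc d, size d = size c, d =i c & cstep d =2 cstep c].

Lemma same_cyc_rot n c : is_cyc c -> same_cyc c (rot n c).
Proof.
move=> cc; split; rewrite ?is_cyc_rot ?size_rot //; first exact: mem_rot.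
exact: cstep_rot.
Qed.

Lemma same_cyc_rev c : is_cyc c -> same_cyc c (rev c).
Proof.
move=> cc; split; rewrite ?is_cyc_rev ?size_rev //; first exact: mem_rev.
exact: cstep_rev.
Qed.

Lemma same_cyc_trans c d e : same_cyc c d -> same_cyc d e -> same_cyc c e.
Proof.
move=> [_ a1 a2 a3] [b0 b1 b2 b3]; split=> //; first by rewrite b1.
  by move=> z; rewrite b2.
by move=> z t; rewrite b3.
Qed.

Lemma cyc_at c x : is_cyc c -> x \in c -> exists s, same_cyc c (x :: s).
Proof.
by move=> cc /rot_to[i s e]; exists s; rewrite -e; apply: same_cyc_rot.
Qed.

Lemma cyc_at2 c x y : is_cyc c -> x \in c -> y \in c -> x != y ->
  exists r1 r2, same_cyc c (x :: r1 ++ y :: r2).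
Proof.
move=> cc /(cyc_at cc)[s sc] yc xy; have [_ _ m _] := sc.
move: yc; rewrite -m inE eq_sym (negPf xy) /= => /splitPr e.
by case: e sc => r1 r2 ?; exists r1, r2.
Qed.

(** Reading the cycle backwards from [x] exchanges the two arcs, so an argument about one arc covers
    both. *)
Lemma cyc_split_swap c x r1 y r2 : is_cyc c -> same_cyc c (x :: r1 ++ y :: r2) ->
  same_cyc c (x :: rev r2 ++ y :: rev r1).
Proof.
move=> cc sc; apply: (same_cyc_trans sc); have [cd _ _ _] := sc.
have := same_cyc_rev cd => h; apply: (same_cyc_trans h).
have [cr _ _ _] := h.
have := same_cyc_rot (size (rev (r1 ++ y :: r2))) cr.
by rewrite rev_cons -cats1 rot_size_cat /= rev_cat rev_cons cat_rcons.
Qed.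

Lemma cyc_edge c x y : is_cyc c -> cstep c x y -> exists s, same_cyc c [:: x, y & s].
Proof.
move=> cc cs; have gxy := is_cyc_step cc cs.
have /andP[xc yc] := cstep_mem cs.
have xy : x != y by apply: contraTneq gxy => ->; rewrite gI.
have [r1 [r2 sc]] := cyc_at2 cc xc yc xy.
have [/and3P[_ _ ud] _ _ e] := sc.
move: cs; rewrite -e cstep_split.
(* On a simple cycle, an arc that contains the edge between its own ends has no inner vertex. *)
have nil_of (a b : V) r1' r2' : a != b -> uniq (a :: r1' ++ b :: r2') ->
    step (a :: rcons r1' b) a b -> r1' = [::].
  case: r1' => [|d r1'] // ab /= /andP[na /andP[nd _]].
  rewrite step_cons2 eqxx /= => /or3P[/eqP E|/andP[/eqP E _]|/step_mem/andP[ad _]].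
  - by rewrite E mem_cat inE eqxx orbT in nd.
  - by rewrite E eqxx in ab.
  - move: na ad; rewrite !inE mem_cat mem_rcons !inE !negb_or => /and4P[/negPf-> /negPf->].
    by rewrite (negPf ab).
case/orP=> h.
  by rewrite (nil_of _ _ _ _ xy ud h) in sc; exists r2.
have sw := cyc_split_swap cc sc; have [/and3P[_ _ ud'] _ _ _] := sw.
have r20 : rev r2 = [::].
  apply: (nil_of _ _ _ _ xy ud').
  by rewrite -(step_rev) rev_cons rev_rcons revK.
by rewrite r20 in sw; exists (rev r1).
Qed.

(* One of the three cycles of a theta graph. *)
Lemma theta_cyc x r1 y r2 s :
  is_cyc (x :: r1 ++ y :: r2) -> path g y (rcons s x) -> uniq s ->
  (forall z, z \in s -> z \notin x :: r1 ++ y :: r2) -> 0 < size r1 + size s ->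
  is_cyc (x :: r1 ++ y :: s).
Proof.
case/and3P=> _ /= pc; rewrite mem_cat inE cat_uniq /= => /and3P[/norP[xr1 /norP[xy xr2]] ur1 h].
move: h => /andP[/norP[yr1 nr] /andP[yr2 ur2]] ps us dis sz.
apply/and3P; split; first by rewrite /= size_cat /=; lia.
  rewrite /= rcons_cat rcons_cons cat_path /=.
  by move: pc; rewrite rcons_cat cat_path /= => /and3P[-> -> _].
have disx z : z \in s -> [/\ z != x, z \notin r1 & z != y].
  by move/dis; rewrite inE mem_cat inE !negb_or => /and4P[-> -> -> _].
rewrite /= mem_cat inE !negb_or xr1 xy /= cat_uniq ur1 /= negb_or yr1 us /=.
have -> : x \notin s by apply/negP=> /disx[]; rewrite eqxx.
have -> : y \notin s by apply/negP=> /disx[]; rewrite eqxx.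
by rewrite !andbT -all_predC; apply/allP=> z /disx[_ ? _].
Qed.

End Cycles.

Section SeqAux.
Variable T : eqType.

Lemma split_first (P : pred T) s : has P s ->
  exists s1 a s2, [/\ s = s1 ++ a :: s2, P a & ~~ has P s1].
Proof.
elim: s => //= b s IH; have [Pb _|/negPf Pb /= /IH[s1 [a [s2 [-> Pa h]]]]] := boolP (P b).
  by exists [::], b, s.
by exists (b :: s1), a, s2; rewrite /= Pb.
Qed.

Lemma split_last (P : pred T) s : has P s ->
  exists s1 a s2, [/\ s = s1 ++ a :: s2, P a & ~~ has P s2].
Proof.
rewrite -has_rev => /split_first[s1 [a [s2 [e Pa h]]]].
exists (rev s2), a, (rev s1); split=> //; last by rewrite has_rev.
by rewrite -[s]revK e rev_cat rev_cons cat_rcons.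
Qed.

Lemma step_mid (s1 s2 : seq T) u v : step (s1 ++ [:: u, v & s2]) u v.
Proof. by rewrite step_cat step_cons2 !eqxx orbT. Qed.

End SeqAux.

Section Ear.
Variables (V : finType) (g : rel V).
Hypotheses (gS : symmetric g) (gI : irreflexive g).
Implicit Types (c s : seq V) (x y : V).

(** Follow [d] from the edge [u v] in both directions until it meets [c], at [a] and [b]. This piece
    of [d] is an ear of [c], and it forms the required cycle with the arc of [c] containing [x y].
    The two common vertices [a0] and [b0] make [a] and [b] distinct. *)
Lemma cyc_through_edges c d x y u v a0 b0 :
  is_cyc g c -> is_cyc g d -> a0 != b0 ->
  a0 \in c -> a0 \in d -> b0 \in c -> b0 \in d ->
  cstep c x y -> cstep d u v ->
  exists e, [/\ is_cyc g e, cstep e x y, cstep e u v & size e + 2 <= size c + size d].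
Proof.
move=> cc cd ab0 a0c a0d b0c b0d cxy duv.
have [s sd] := cyc_edge gS gI cd duv; have [cs szd md _] := sd.
(* [q] runs around [d] from [v] to [u], so its first and last vertices on [c] are the ones nearest
   to the edge [u v]. *)
pose q := v :: rcons s u.
have sdq : same_cyc g d q.
  by apply: (same_cyc_trans sd); have := same_cyc_rot 1 cs; rewrite /rot /= cats1.
have [cq _ mq _] := sdq.
have hq : has [in c] q by apply/hasP; exists a0; rewrite // mq.
have [q1 [a [q' [eq ac nq1]]]] := split_first hq.
have uq : uniq q by case/and3P: cq.
have hq' : has [in c] q'.
  have : (a0 != a) || (b0 != a).
    by rewrite -negb_and; apply: contra ab0 => /andP[/eqP-> /eqP->].
  have in_q' z : z \in c -> z \in d -> z != a -> z \in q'.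
    move=> zc; rewrite -mq eq mem_cat inE => /orP[zq1 _|/orP[->//|//]].
    by case/hasP: nq1; exists z.
  by case/orP=> h; apply/hasP; [exists a0|exists b0] => //; apply: in_q'.
have [q2 [b [q3 [eq' bc nq3]]]] := split_last hq'.
have eqq : q = q1 ++ a :: q2 ++ b :: q3 by rewrite eq eq'.
have sdr : same_cyc g d (a :: q2 ++ b :: (q3 ++ q1)).
  apply: (same_cyc_trans sdq); have := same_cyc_rot (size q1) cq.
  by rewrite {2}eqq rot_size_cat /= -catA.
have [/and3P[_ pr ur] szr mr _] := sdr.
set I := q3 ++ q1 in sdr pr ur szr mr.
have pI : path g b (rcons I a).
  by move: pr; rewrite /= rcons_cat cat_path /= => /and3P[].
have [ab uI] : a != b /\ uniq I.
  move: ur; rewrite /= mem_cat inE !negb_or cat_uniq /= => /andP[/and3P[_ -> _]].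
  by case/and3P=> _ _ /andP[].
have disI z : z \in I -> z \notin c.
  rewrite mem_cat => zI; apply/negP=> zc.
  by case/orP: zI => zI; [case/hasP: nq3|case/hasP: nq1]; exists z.
have stepI : step (b :: rcons I a) u v.
  have e1 : rcons q1 a = v :: behead (rcons q1 a).
    by case: (q1) eqq => [|w w'] [-> _].
  have e2 : b :: q3 = rcons (belast b q3) u.
    have := congr1 (last u) eqq; rewrite /q /= last_rcons last_cat /= last_cat /= => ->.
    by rewrite lastI.
  rewrite -cats1 -catA cats1 -cat_cons e2 e1 cat_rcons; exact: step_mid.
have [r1 [r2 sc]] := cyc_at2 cc ac bc ab.
have main r1' r2' : same_cyc g c (a :: r1' ++ b :: r2') ->
    step (a :: rcons r1' b) x y ->
    exists e, [/\ is_cyc g e, cstep e x y, cstep e u v & size e + 2 <= size c + size d].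
  move=> [cc' szc mc ec] hs.
  (* Without inner vertices on either side, [x y] and [u v] are both the edge [a b], and [c] itself
     serves. *)
  have [/eqP sz0|sz] := posnP (size r1' + size I).
    move: sz0; rewrite addn_eq0 !size_eq0 => /andP[/eqP r10 /eqP I0].
    exists c; split=> //.
      move: stepI; rewrite -ec /= r10 I0 !step_cons2.
      by case/or3P=> [/andP[-> ->]|/andP[-> ->]|//]; rewrite ?orbT.
    by rewrite leq_add2l; case/and3P: cd => /ltnW.
  exists (a :: r1' ++ b :: I).
  have ce : is_cyc g (a :: r1' ++ b :: I).
    by apply: theta_cyc sz => //; [exact: cc'|move=> z /disI; rewrite mc].
  split=> //; first by rewrite cstep_split hs.
    by rewrite cstep_split stepI orbT.
  by move: szc szr; rewrite /= !size_cat /= => <- <-; clear; lia.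
have [_ _ _ ec] := sc.
move: (cxy); rewrite -ec cstep_split => /orP[h|h]; first exact: main sc h.
apply: main (cyc_split_swap gS cc sc) _.
by rewrite -(step_rev) rev_cons rev_rcons revK.
Qed.

End Ear.

(** * Classes of edges on short cycles *)

Section ShortCycleClasses.
Variables (V : finType) (g : rel V) (l : nat).
Hypotheses (gS : symmetric g) (gI : irreflexive g) (l3 : 2 < l).
Hypothesis gap : forall c, is_cyc g c -> size c < l \/ l.*2 < size c.
Implicit Types (c s : seq V) (x y u v : V).

Definition same_edge x y u v := (x == u) && (y == v) || (x == v) && (y == u).

(** The first disjunct makes the relation reflexive also on edges that lie on no short cycle. *)
Definition tied x y u v : Prop := same_edge x y u v \/
  exists c, [/\ is_cyc g c, size c < l, cstep c x y & cstep c u v].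

Lemma same_edgeC x y u v : same_edge x y u v = same_edge u v x y.
Proof. by rewrite /same_edge !(eq_sym x) !(eq_sym y) [(v == x) && _]andbC. Qed.

Lemma same_edgeP x y u v : same_edge x y u v -> (u = x /\ v = y) \/ (u = y /\ v = x).
Proof. by case/orP=> /andP[/eqP-> /eqP->]; [left|right]. Qed.

Lemma tied_refl x y : tied x y x y.
Proof. by left; rewrite /same_edge !eqxx. Qed.

Lemma tied_sym x y u v : tied x y u v -> tied u v x y.
Proof.
by case=> [|[c [? ? ? ?]]]; [rewrite same_edgeC; left|right; exists c].
Qed.

Lemma tied_flip x y u v : tied x y u v -> tied x y v u.
Proof.
case=> [/same_edgeP[[-> ->]|[-> ->]]|[c [? ? ?]]]; first by left; rewrite /same_edge !eqxx orbT.
  by left; rewrite /same_edge !eqxx.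
by rewrite cstepC => ?; right; exists c.
Qed.

Lemma tied_cyc c x y u v : is_cyc g c -> size c < l -> cstep c x y -> cstep c u v ->
  tied x y u v.
Proof. by move=> *; right; exists c. Qed.

(** The cycle through the two outer edges, built from two short cycles, has fewer than [2 l]
    vertices, so [gap] makes it short. *)
Lemma tied_trans x y u v w z : tied x y u v -> tied u v w z -> tied x y w z.
Proof.
case=> [/same_edgeP[[-> ->]//|[-> -> h]]|[c [cc sc cxy cuv]]].
  by apply/tied_sym/tied_flip/tied_sym.
case=> [/same_edgeP[[-> ->]|[-> ->]]|[d [cd sd duv dwz]]].
- exact: (tied_cyc cc).
- by apply: (tied_cyc cc) => //; rewrite cstepC.
have uv : u != v by apply: contraTneq (is_cyc_step gS cc cuv) => ->; rewrite gI.
have /andP[uc vc] := cstep_mem cuv; have /andP[ud vd] := cstep_mem duv.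
have [e [ce e1 e2 se]] := cyc_through_edges gS gI cc cd uv uc ud vc vd cxy dwz.
right; exists e; split=> //.
by case: (gap ce) => //; clear -se sc sd; lia.
Qed.

Section OneClass.
Variables (x0 y0 : V).

Let inK c := forall x y, cstep c x y -> tied x0 y0 x y.

(* A path with edges in the class, strictly shorter than both arcs of [C]
   between its ends. *)
Let shortcut C x y r1 r2 s :=
  [/\ same_cyc g C (x :: r1 ++ y :: r2), path g x (rcons s y) /\ uniq (x :: rcons s y),
      forall a b, step (x :: rcons s y) a b -> tied x0 y0 a b,
      size s < size r1 & size s < size r2].

(** If [s] meets [C] at [z], then [z] cuts both [s] and an arc of [C] in two. As [s] is shorter than
    this arc, one piece of [s] is shorter than the matching piece of the arc, and it is a smaller
    shortcut. *)
Lemma shortcut_ear C : is_cyc g C ->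
  forall n x y r1 r2 s, shortcut C x y r1 r2 s -> size s <= n ->
  exists x y r1 r2 s, shortcut C x y r1 r2 s /\ ~~ has [in C] s.
Proof.
move=> cC; elim=> [|n IH] x y r1 r2 s sh sn.
  exists x, y, r1, r2, s; split=> //.
  by move: sn; rewrite leqn0 size_eq0 => /eqP->.
have [/hasP[z zs zC]|] := boolP (has [in C] s); last by exists x, y, r1, r2, s.
have main q1 q2 : shortcut C x y q1 q2 s -> z \in q1 ->
    exists x y r1 r2 s, shortcut C x y r1 r2 s /\ ~~ has [in C] s.
  case=> sc [ps us] Ks z1 z2 /splitPr eq1; case: eq1 sc z1 => s1 s2 sc z1.
  case/splitPr: zs ps us Ks z1 z2 sn {sh} => R1 R2.
  rewrite rcons_cat rcons_cons -cat_cons cat_uniq cat_path /= !size_cat /=.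
  move=> /and3P[p1 p1z p2] /and3P[u1 u12 u2] Ks z1 z2 sn.
  have step1 a b : step (x :: rcons R1 z) a b -> tied x0 y0 a b.
    by move=> h; apply: Ks; rewrite -cat_cons step_cat rcons_cons h.
  have step2 a b : step (z :: rcons R2 y) a b -> tied x0 y0 a b.
    by move=> h; apply: Ks; rewrite -cat_cons step_cat h orbT.
  have [h|h] := ltnP (size R1) (size s1).
    apply: (IH x z s1 (s2 ++ y :: q2) R1); last by clear -sn; lia.
    split=> //; first by move: sc; rewrite -catA.
      split; first by rewrite rcons_path p1.
      rewrite -rcons_cons rcons_uniq -[uniq _]/(_ && _) u1 andbT.
      by move: u12; rewrite negb_or => /andP[].
    by rewrite size_cat /=; clear -z2; lia.
  apply: (IH z y s2 (q2 ++ x :: s1) R2); last by clear -sn; lia.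
  split=> //.
  - apply: (same_cyc_trans sc); have [cd _ _ _] := sc.
    have := same_cyc_rot (size (x :: s1)) cd.
    by rewrite -[x :: (_ ++ _) ++ _]/((x :: _ ++ _) ++ _) -cat_cons -catA rot_size_cat /= -catA.
  - have aux (a b c d : nat) : a + c.+1 < b + d.+1 -> b <= a -> c < d by clear; lia.
    exact: aux z1 h.
  - by move: z2; clear; rewrite size_cat /=; lia.
have [sc [ps us] Ks z1 z2] := sh.
have [_ _ mC _] := sc; move: zC; rewrite -mC inE mem_cat inE.
move: (us); rewrite /= mem_rcons inE rcons_uniq !negb_or => /andP[/andP[_ xs] /andP[ys _]].
case/or4P=> [/eqP e|h|/eqP e|h].
- by rewrite -e zs in xs.
- exact: main sh h.
- by rewrite -e zs in ys.
- apply: (main (rev r2) (rev r1)); last by rewrite mem_rev.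
  by split; rewrite ?size_rev //; apply: cyc_split_swap.
Qed.

(** A long [C] in one class has a shortcut off [C] in the same class. The shortcut splits [C] into
    two smaller cycles, short by induction, whose lengths add up to more than [size C]; so [C] has
    fewer than [2 l] vertices, against [gap]. *)
Lemma class_cyc_short C : is_cyc g C -> inK C -> size C < l.
Proof.
have [n] := ubnP (size C); elim: n C => // n IH C sCn cC KC.
case: (gap cC) => // big; exfalso.
have tiedK a b u v : tied x0 y0 a b -> tied x0 y0 u v -> tied a b u v.
  by move=> /tied_sym; apply: tied_trans.
have [x [y [r1 [r2 [s sh]]]]] : exists x y r1 r2 s, shortcut C x y r1 r2 s.
  case: C {IH} sCn cC KC big => [|x [|x' C]] //=.
  set D := [:: x, x' & C] => sCn cC KC big.
  (* The edges [x x'] and [y y'] are chosen with [l - 1] vertices of [C] between [x] and [y] on one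
     side and at least [l] on the other. A short cycle through both edges has at most [l - 3]
     vertices besides [x] and [y], so its arc is a shortcut. *)
  have szC : l.-2 < size C by clear -big l3; lia.
  case E : (drop l.-2 C) => [|y r2].
    by move: szC; rewrite -subn_gt0 -size_drop E.
  have eC : C = take l.-2 C ++ y :: r2 by rewrite -E cat_take_drop.
  have sr1 : size (take l.-2 C) = l.-2 by rewrite size_takel // ltnW.
  have sr2 : l.-2 + (size r2).+1 = size C by rewrite [in RHS]eC size_cat sr1.
  set r1 := take l.-2 C in eC sr1.
  have eD : D = x :: (x' :: r1) ++ y :: r2 by rewrite /D eC.
  have KD1 : cstep D x x' by rewrite /D /cstep /= step_cons2 !eqxx.
  case er2 : r2 => [|y' r3]; first by move: sr2 big; rewrite er2 /=; clear -l3; lia.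
  have KD2 : cstep D y y'.
    by rewrite eD cstep_split er2 rcons_cons [X in _ || X]step_cons2 !eqxx orbT.
  have /and3P[_ _ uD] := cC.
  have [yx yx'] : y != x /\ y != x'.
    move: uD; rewrite eD /= !(inE, mem_cat) !negb_or.
    by case/and3P=> /and4P[_ _ yx _] /and3P[_ yx' _] _; split; rewrite eq_sym.
  case: (tiedK _ _ _ _ (KC _ _ KD1) (KC _ _ KD2)) => [/same_edgeP[[e _]|[e _]]|[S [cS sS S1 S2]]].
  - by rewrite e eqxx in yx.
  - by rewrite e eqxx in yx'.
  have xy : x != y by rewrite eq_sym.
  have /andP[xS _] := cstep_mem S1; have /andP[yS _] := cstep_mem S2.
  have [t1 [t2 sc]] := cyc_at2 cS xS yS xy.
  have [/and3P[_ pS uS] szS _ eS] := sc.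
  exists x, y, (x' :: r1), r2, t1; split.
  - by rewrite -eD; split.
  - split.
      by move: pS; rewrite /= rcons_cat cat_path => /and3P[p1 p2 _]; rewrite rcons_path p1.
    move: uS; rewrite -cat_cons -cat_rcons cat_uniq => /andP[+ _].
    by rewrite rcons_cons.
  - move=> a b h; apply: (tied_trans (KC _ _ KD1)).
    by apply: (tied_cyc cS) => //; rewrite -eS cstep_split h.
  - by move: szS sS; rewrite /= size_cat /= sr1; clear -l3; lia.
  - by move: szS sS sr2 big; rewrite /D /= size_cat /=; clear -l3; lia.
have [{x y r1 r2 s sh} x [y [r1 [r2 [s [[sc [ps us] Ks z1 z2] nC]]]]]] :=
  shortcut_ear cC sh (leqnn _).
have [_ _ _ eC] := sc.
move: us; rewrite /= mem_rcons inE rcons_uniq !negb_or => /andP[/andP[_ xs] /andP[ys us]].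
have theta q1 q2 : same_cyc g C (x :: q1 ++ y :: q2) -> size s < size q1 ->
    size s < size q2 -> size q1 + size s + 2 < l.
  move=> scq h1 h2; have [cq szq mq eq] := scq.
  have cq' : is_cyc g (x :: q1 ++ y :: rev s).
    apply: theta_cyc cq _ _ _ _; rewrite ?rev_uniq ?size_rev //.
    - by rewrite -path_revS.
    - by move=> z; rewrite mem_rev mq => zs; apply: contra nC => zC; apply/hasP; exists z.
    - by clear -h1; lia.
  have := IH _ _ cq' _; rewrite /= size_cat /= size_rev => IH'.
  move: IH'; rewrite addnS addn2 => IH'; apply: IH'.
    by move: sCn szq; rewrite /= size_cat /=; clear -h2; lia.
  move=> a b; rewrite cstep_split => /orP[h|h].
    by apply: KC; rewrite -eq cstep_split h.
  by apply: Ks; rewrite -step_rev rev_cons rev_rcons.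
have h1 := theta _ _ sc z1 z2.
have := theta _ _ (cyc_split_swap gS cC sc); rewrite !size_rev => /(_ z2 z1) h2.
have [_ szC _ _] := sc.
by move: szC; rewrite /= size_cat /=; clear -big h1 h2; lia.
Qed.

End OneClass.
End ShortCycleClasses.

(** * Disjoint cycles in graphs of maximum degree 3 *)

Section EdgeCount.
Variables (V : finType) (h : rel V).
Hypotheses (hS : symmetric h) (hI : irreflexive h).
Implicit Types (A B C P R : {set V}) (x y w : V).

Definition dg A x := #|[set y in A | h x y]|.

(** Ordered pairs are counted, so [cross A A] counts every edge inside [A] twice. *)
Definition cross A B := \sum_x \sum_y ((x \in A) && (y \in B) && h x y : nat).

Definition nedges A := (cross A A)./2.

Lemma dgE A x : dg A x = \sum_y ((y \in A) && h x y : nat).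
Proof.
rewrite /dg -sum1_card big_mkcond /=; apply: eq_bigr => y _.
by rewrite inE; case: (_ && _).
Qed.

Lemma crossE A B : cross A B = \sum_(x in A) dg B x.
Proof.
rewrite [RHS]big_mkcond /=; apply: eq_bigr => x _; case: ifP => xA.
  by rewrite dgE; apply: eq_bigr.
by rewrite big1.
Qed.

Lemma crossC A B : cross A B = cross B A.
Proof.
rewrite /cross exchange_big /=; apply: eq_bigr => x _; apply: eq_bigr => y _.
by rewrite hS [(_ \in A) && _]andbC.
Qed.

Lemma cross_union A B C : [disjoint A & B] -> cross (A :|: B) C = cross A C + cross B C.
Proof.
by move=> d; rewrite !crossE -bigU //; apply: eq_bigl => x; rewrite !inE.
Qed.

Lemma cross_sq A B : [disjoint A & B] ->
  cross (A :|: B) (A :|: B) = cross A A + cross B B + (cross A B).*2.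
Proof.
move=> d; rewrite cross_union // !(crossC _ (A :|: B)) !cross_union // (crossC B A).
by rewrite -addnn; clear; lia.
Qed.

Lemma dg0 A x : (forall y, y \in A -> ~~ h x y) -> dg A x = 0.
Proof. by move=> nA; apply/eqP; rewrite cards_eq0; apply/eqP/setP=> y; rewrite !inE; apply/andP=> -[/nA/negP]. Qed.

Lemma cross1l x A : cross [set x] A = dg A x.
Proof. by rewrite crossE big_set1. Qed.

Lemma cross11 x : cross [set x] [set x] = 0.
Proof. by rewrite cross1l dg0 // => y /set1P->; rewrite hI. Qed.

Lemma cross_even A : ~~ odd (cross A A).
Proof.
have [n] := ubnP #|A|; elim: n A => // n IH A An.
have [->|[x xA]] := set_0Vmem A; first by rewrite crossE big_set0.
rewrite -(setD1K xA) cross_sq; last by rewrite disjoints1 !inE eqxx.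
rewrite cross11 oddD odd_double addbF IH //.
by move: An; rewrite (cardsD1 x) xA.
Qed.

Lemma crossAA A : cross A A = (nedges A).*2.
Proof. by rewrite -[LHS]odd_double_half (negPf (cross_even A)). Qed.

Lemma nedges_add A w : w \notin A -> nedges (w |: A) = nedges A + dg A w.
Proof.
move=> wA; apply: double_inj; rewrite -crossAA cross_sq ?disjoints1 //.
by rewrite cross11 cross1l crossAA doubleD.
Qed.

Lemma nedges_union A B : [disjoint A & B] ->
  nedges (A :|: B) = nedges A + nedges B + cross A B.
Proof.
by move=> d; apply: double_inj; rewrite -crossAA cross_sq // !crossAA !doubleD.
Qed.

(** Supermodularity: an edge inside either set is inside the union, and one inside both is inside
    the intersection. *)
Lemma nedges_super A B : nedges A + nedges B <= nedges (A :|: B) + nedges (A :&: B).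
Proof.
rewrite -leq_double !doubleD -!crossAA /cross -!big_split /=.
apply: leq_sum => x _; rewrite -!big_split /=; apply: leq_sum => y _.
rewrite !inE.
by case: (x \in A); case: (x \in B); case: (y \in A); case: (y \in B); case: (h x y).
Qed.

Lemma dg_le A B x : A \subset B -> dg A x <= dg B x.
Proof.
move=> AB; apply: subset_leq_card; apply/subsetP=> y; rewrite !inE => /andP[yA ->].
by rewrite (subsetP AB).
Qed.

Lemma dgU A B x : [disjoint A & B] -> dg (A :|: B) x = dg A x + dg B x.
Proof.
move=> d; rewrite -!cross1l crossC cross_union //.
by rewrite !(crossC [set x]).
Qed.

Lemma nedges_split A C : C \subset A ->
  nedges (A :\: C) + \sum_(x in C) dg A x = nedges A + nedges C.
Proof.
move=> CA.
have eA : A = C :|: (A :\: C).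
  by apply/setP=> x; rewrite !inE; case xC: (x \in C); rewrite //= (subsetP CA _ xC).
have dis : [disjoint C & A :\: C].
  by rewrite -setI_eq0; apply/eqP/setP=> x; rewrite !inE; case: (x \in C).
rewrite -crossE crossC {2 3}eA cross_union // nedges_union // crossAA.
by rewrite -addnn (crossC _ C); clear; lia.
Qed.

(* [B] is minimal, so that removing a vertex lowers the excess below [m]. *)
Lemma dense_core A m : A != set0 -> #|A| + m <= nedges A ->
  exists B, [/\ B \subset A, B != set0, #|B| + m <= nedges B &
    forall x, x \in B -> 2 <= dg B x /\ nedges B + 1 < #|B| + m + dg B x].
Proof.
have [n] := ubnP #|A|; elim: n A => // n IH A An A0 Am.
have [[x [xA hx]]|no] := pselect (exists x, x \in A /\ #|A :\ x| + m <= nedges (A :\ x)).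
  have [||//|B [BA B0 Bm hB]] := IH (A :\ x).
  - by move: An; rewrite (cardsD1 x) xA; clear; lia.
  - apply: contraTneq Am => e; have := setD1K xA; rewrite e setU0 => <-.
    by rewrite /nedges cross11 cards1.
  - by exists B; split=> //; apply: subset_trans BA (subsetDl _ _).
exists A; split=> // x xA.
have xD : x \notin A :\ x by rewrite !inE eqxx.
have := nedges_add xD; rewrite setD1K //.
have -> : dg (A :\ x) x = dg A x.
  by apply: eq_card => y; rewrite !inE; case: (eqVneq y x) => [->|//]; rewrite hI !andbF.
have lt : nedges (A :\ x) < #|A :\ x| + m by rewrite ltnNge; apply/negP=> le; case: no; exists x.
by move: Am lt; rewrite (cardsD1 x A) xA; clear; lia.
Qed.

(** In a core of minimum degree 2, the first vertex of a longest path has all its neighbours on the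
    path, and one other than its successor closes a cycle. *)
Lemma set_cyc A : A != set0 -> #|A| <= nedges A ->
  exists c, is_cyc h c /\ {subset c <= A}.
Proof.
move=> A0 AE; have [||B [BA B0 _ hB]] := @dense_core A 0; rewrite ?addn0 //.
have {}hB x : x \in B -> 2 <= dg B x by case/hB.
pose P n := `[< exists x s, [/\ path h x s, uniq (x :: s), {subset x :: s <= B} & size s = n] >].
have [b bB] := set0Pn _ B0.
have exP : exists n, P n.
  exists 0; apply/asboolP; exists b, [::]; split=> // z.
  by rewrite inE => /eqP->.
have bdP n : P n -> n <= #|V|.
  move/asboolP=> [x [s [_ /card_uniqP us _ <-]]].
  by apply: leq_trans (max_card [in x :: s]); rewrite us /=.
case: (ex_maxnP exP bdP) => n /asboolP[x [s [ps us sB szs]]] mx.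
have ins y : y \in B -> h x y -> y \in s.
  move=> yB hxy; apply: contraT => ys.
  have : P n.+1.
    apply/asboolP; exists y, (x :: s); split; rewrite /= ?szs //.
    - by rewrite hS hxy.
    - rewrite (us : (_ && _) = true) andbT inE negb_or ys andbT.
      by apply: contraTneq hxy => ->; rewrite hI.
    - by move=> z; rewrite inE => /orP[/eqP->//|/sB].
  by move/mx; rewrite ltnn.
have xB : x \in B by apply: sB; rewrite inE eqxx.
have := hB _ xB => /card_gt1P[y1 [y2 [+ + y12]]].
rewrite !inE => /andP[y1B h1] /andP[y2B h2].
have [y [yB hy ny]] : exists y, [/\ y \in B, h x y & y != head x s].
  have [e|] := eqVneq y1 (head x s); last by exists y1.
  by exists y2; split=> //; rewrite -e eq_sym.
have /splitPr es := ins y yB hy; case: es ps us sB {szs ins} ny => s1 s2.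
rewrite cat_path /= => /and3P[p1 p2 _] u12 sB ny.
exists (x :: rcons s1 y); split.
  apply/and3P; split.
  - by rewrite /= size_rcons; case: (s1) ny => //=; rewrite eqxx.
  - by rewrite /= !rcons_path last_rcons p1 p2 hS.
  - move: u12; rewrite -[_ && _]/(uniq (x :: _)) -cat_rcons -cat_cons cat_uniq.
    by case/andP.
move=> z; rewrite -rcons_cons mem_rcons inE => zs; apply/(subsetP BA)/sB.
by rewrite -cat_cons mem_cat [z \in y :: _]inE; case/orP: zs => ->; rewrite ?orbT.
Qed.


(** * Cyclic sets with few vertices of degree 3 *)

Section SmallCyclicSet.
Variables (A : {set V}) (t : nat).
Hypotheses (deg23 : forall x, x \in A -> 2 <= dg A x <= 3) (t0 : 0 < t).

(** Serves as the length of paths and cycles: vertices of degree 2 cost nothing and need not be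
    suppressed. *)
Definition n3 C := #|[set x in C | dg A x == 3]|.

Lemma n3U B C : n3 (B :|: C) + n3 (B :&: C) = n3 B + n3 C.
Proof.
rewrite /n3 -[RHS]cardsUI; congr (_ + _); apply: eq_card => x.
  by rewrite !inE andb_orl.
by rewrite !inE andbACA andbb.
Qed.

Lemma n3S B C : B \subset C -> n3 B <= n3 C.
Proof.
move=> BC; apply: subset_leq_card; apply/subsetP=> x; rewrite !inE => /andP[xB ->].
by rewrite (subsetP BC).
Qed.

Lemma n3_add w B : n3 (w |: B) <= n3 B + (dg A w == 3).
Proof.
have := n3U [set w] B; have : n3 [set w] <= (dg A w == 3).
  rewrite /n3; case: eqP => e; last first.
    by rewrite leqn0 cards_eq0; apply/eqP/setP=> x; rewrite !inE; case: eqP => // ->; apply/eqP.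
  apply: (@leq_trans #|[set w]|); last by rewrite cards1.
  by apply: subset_leq_card; apply/subsetP=> x; rewrite !inE => /andP[].
by clear; lia.
Qed.

Lemma sum_dg C : C \subset A -> \sum_(x in C) dg A x = #|C|.*2 + n3 C.
Proof.
move=> CA; rewrite -muln2 -sum_nat_const /n3 -sum1_card.
rewrite [X in _ + X]big_mkcond [X in X + _]big_mkcond -big_split big_mkcond /=.
apply: eq_bigr => x _; rewrite inE; case xC: (x \in C) => //=.
by have := deg23 (subsetP CA _ xC); case: (dg A x) => [|[|[|[|]]]].
Qed.

Section Sparse.
Hypothesis sparse : forall C, C \subset A -> C != set0 -> n3 C <= t.*2.-1 -> nedges C < #|C|.
Variable v0 : V.
Hypotheses (v0A : v0 \in A) (v03 : dg A v0 = 3).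

(** Stands for the path from [v0] to [w] in the tree. Only the edge count of a connected set is
    kept, so that arms are glued by arithmetic. *)
Let arm R s P w := [/\ v0 \in P, w \in P, P \subset R, #|P| <= nedges P + 1 & n3 P <= s].

(* A ball around [v0]: a tree in which every vertex is reached through at
   most [s] vertices of degree 3. *)
Let ball R s := [/\ v0 \in R, R \subset A, nedges R < #|R| &
  forall w, w \in R -> exists P, arm R s P w].

(** The intersection contains [v0] and few vertices of degree 3, so [sparse] bounds its edges; by
    supermodularity the union then has at least the edges of a tree. The 1 gained in the second
    bound is [v0], counted in both arms. *)
Lemma arm_glue R s s' P P' w w' : R \subset A -> s <= t -> s' <= t ->
  arm R s P w -> arm R s' P' w' ->
  #|P :|: P'| <= nedges (P :|: P') + 1 /\ n3 (P :|: P') + 1 <= s + s'.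
Proof.
move=> RA st st' [v0P _ PR eP nP] [v0P' _ _ eP' nP'].
have v0I : v0 \in P :&: P' by rewrite inE v0P.
have n3I : 0 < n3 (P :&: P').
  by apply/card_gt0P; exists v0; rewrite inE v0I v03 eqxx.
have : nedges (P :&: P') < #|P :&: P'|.
  apply: sparse.
  - by apply: subset_trans RA; apply: subset_trans PR; apply: subsetIl.
  - by apply/set0Pn; exists v0.
  - have : n3 (P :&: P') <= n3 P by apply: n3S; apply: subsetIl.
    by move: nP st t0; clear; lia.
have := nedges_super P P'; have := cardsUI P P'; have := n3U P P'.
by split; lia.
Qed.

(** A second neighbour in [R] would add two edges and one vertex to the union of two arms, against
    [sparse]. *)
Lemma ball_dg_le1 R s w : s <= t -> s.*2.-1 + (dg A w == 3) <= t.*2.-1 ->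
  ball R s -> w \in A -> w \notin R -> dg R w <= 1.
Proof.
move=> st sz [v0R RA _ arms] wA wR; rewrite leqNgt; apply/negP=> /card_gt1P[x [y [+ + xy]]].
rewrite !inE => /andP[xR hwx] /andP[yR hwy].
have [P armP] := arms x xR; have [P' armP'] := arms y yR.
have [e1 e2] := arm_glue RA st st armP armP'.
case: armP armP' => [v0P xP PR _ _] [_ yP' PR' _ _].
have UR : P :|: P' \subset R by rewrite subUset PR.
have wU : w \notin P :|: P' by apply: contra wR; apply: (subsetP UR).
have : 2 <= dg (P :|: P') w.
  apply/card_gt1P; exists x, y; split=> //; rewrite !inE ?xP ?yP' ?hwx ?hwy ?orbT //.
have : nedges (w |: (P :|: P')) < #|w |: (P :|: P')|.
  apply: sparse.
  - by rewrite subUset sub1set wA (subset_trans UR RA).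
  - by apply/set0Pn; exists w; rewrite inE set11.
  - have := n3_add w (P :|: P'); move: sz e2 st t0.
    by case: (_ == _) => /=; clear; lia.
by rewrite nedges_add // cardsU1 wU; move: e1; clear; lia.
Qed.

Lemma ball_add2 R s w x : s <= t -> ball R s -> w \in A -> w \notin R -> dg A w != 3 ->
  x \in R -> h w x -> ball (w |: R) s.
Proof.
move=> st bR wA wR w3 xR hwx; have [v0R RA eR arms] := bR.
have d1 : dg R w = 1.
  apply/eqP; rewrite eqn_leq (ball_dg_le1 st _ bR) ?(negPf w3) ?addn0 //; last first.
    by move: st; clear; lia.
  by apply/card_gt0P; exists x; rewrite inE xR.
split.
- by rewrite inE v0R orbT.
- by rewrite subUset sub1set wA.
- by rewrite nedges_add // d1 cardsU1 wR addnC ltn_add2l.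
- move=> z; rewrite !inE => /orP[/eqP->|zR]; last first.
    have [P [h1 h2 h3 h4 h5]] := arms z zR; exists P; split=> //.
    exact: subset_trans h3 (subsetUr _ _).
  have [P [h1 h2 h3 h4 h5]] := arms x xR; exists (w |: P).
  have wP : w \notin P by apply: contra wR; apply: (subsetP h3).
  split; rewrite ?inE ?eqxx ?h1 ?orbT //; first exact: setUS.
    rewrite nedges_add // cardsU1 wP.
    have : 0 < dg P w by apply/card_gt0P; exists x; rewrite inE h2.
    by move: h4; clear; lia.
  by have := n3_add w P; rewrite (negPf w3) addn0 => /leq_trans; apply.
Qed.

(** An outside neighbour of degree 2 can be absorbed without raising [s]; this is repeated until
    none is left. *)
Lemma ball_close R s : s <= t -> ball R s ->
  exists R', [/\ R \subset R', ball R' s &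
    forall w x, w \in A -> w \notin R' -> x \in R' -> h w x -> dg A w = 3].
Proof.
move=> st; have [n] := ubnP #|~: R|; elim: n R => // n IH R Rn bR.
have [[w [x [wA wR xR hwx w3]]]|no] := pselect (exists w x,
  [/\ w \in A, w \notin R, x \in R, h w x & dg A w != 3]).
  have [||R' [s1 s2 s3]] := IH (w |: R).
  - move: Rn; rewrite (cardsD1 w (~: R)) inE wR /=.
    by have -> : ~: R :\ w = ~: (w |: R) by apply/setP=> z; rewrite !inE negb_or.
  - exact: ball_add2 w3 xR hwx.
  - by exists R'; split=> //; apply: subset_trans s1; apply: subsetUr.
exists R; split=> // w x wA wR xR hwx; apply/eqP; apply: contraT => w3.
by case: no; exists w, x.
Qed.

(** Each vertex of the next layer [W] has exactly one neighbour in [R], so [#|W|] counts the edges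
    leaving [R]. As [R] has degrees 2 and 3 and fewer edges than vertices, there are at least
    [n3 R + 2] of them. No edge joins two vertices of [W], so [R :|: W] is again a ball. *)
Lemma ball_step R s : 0 < s < t -> ball R s ->
  (forall w x, w \in A -> w \notin R -> x \in R -> h w x -> dg A w = 3) ->
  exists R', ball R' s.+1 /\ (n3 R + 2).*2 <= n3 R' + 2.
Proof.
move=> /andP[s0 st] bR cl; have [v0R RA eR arms] := bR.
pose W := [set w in A :\: R | [exists x in R, h w x]].
have WA : W \subset A by apply/subsetP=> w; rewrite !inE => /andP[/andP[]].
have WP w : w \in W -> [/\ w \in A, w \notin R, dg A w = 3 & exists x, x \in R /\ h w x].
  rewrite !inE => /andP[/andP[wR wA] /existsP[x /andP[xR hwx]]].
  by split=> //; [apply: cl hwx | exists x].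
have dRW : [disjoint R & W].
  rewrite disjoint_subset; apply/subsetP=> x xR; rewrite inE; apply/negP.
  by case/WP=> _; rewrite xR.
have d1 w : w \in W -> dg R w = 1.
  move=> /WP[wA wR w3 [x [xR hwx]]].
  apply/eqP; rewrite eqn_leq (ball_dg_le1 _ _ bR) ?w3 //=; first last.
  - by move: st s0; clear; lia.
  - exact: ltnW.
  by apply/card_gt0P; exists x; rewrite inE xR.
have EW : nedges W = 0.
  apply/eqP; rewrite -double_eq0 -crossAA crossE sum_nat_eq0; apply/forallP=> w.
  apply/implyP=> wW; rewrite cards_eq0; apply/eqP/setP=> w'.
  rewrite in_set0 in_set; apply/negP=> /andP[w'W hww'].
  have [wA wR w3 [x [xR hwx]]] := WP _ wW; have [w'A w'R w'3 [y [yR hwy]]] := WP _ w'W.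
  have [P armP] := arms x xR; have [P' armP'] := arms y yR.
  have [e1 e2] := arm_glue RA (ltnW st) (ltnW st) armP armP'.
  case: armP armP' => [v0P xP PR _ _] [_ yP' PR' _ _].
  have UR : P :|: P' \subset R by rewrite subUset PR.
  have wU : w \notin P :|: P' by apply: contra wR; apply: (subsetP UR).
  have w'U : w' \notin w |: (P :|: P').
    rewrite inE negb_or; apply/andP; split; last by apply: contra w'R; apply: (subsetP UR).
    by apply/negP=> /set1P e; rewrite e hI in hww'.
  (* Two new vertices bring three edges, [w w'] and one from each to the arms. At most
     [2 s - 1 + 2 <= 2 t - 1] vertices have degree 3. *)
  have : nedges (w' |: (w |: (P :|: P'))) < #|w' |: (w |: (P :|: P'))|.
    apply: sparse.
    - by rewrite !subUset !sub1set wA w'A (subset_trans PR RA) (subset_trans PR' RA).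
    - by apply/set0Pn; exists w; rewrite !inE eqxx orbT.
    - have := n3_add w (P :|: P'); have := n3_add w' (w |: (P :|: P')).
      by rewrite w3 w'3 /=; move: e2 st s0; clear; lia.
  rewrite !nedges_add // !cardsU1 wU w'U.
  have : 0 < dg (P :|: P') w by apply/card_gt0P; exists x; rewrite !inE xP.
  have : 1 < dg (w |: (P :|: P')) w'.
    apply/card_gt1P; exists w, y; split; rewrite ?inE ?eqxx ?yP' ?hwy ?orbT //=.
      by rewrite hS.
    by apply: contraNneq wR => ->.
  by move: e1; clear; lia.
have cRW : cross W R = #|W|.
  by rewrite crossE -sum1_card; apply: eq_bigr => w /d1.
have cR : cross R (A :\: R) = #|W|.
  rewrite -cRW crossC !crossE (big_setID W) /=.
  have -> : (A :\: R) :&: W = W.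
    by apply/setIidPr/subsetP=> w; rewrite inE => /andP[].
  rewrite [X in _ + X]big1 ?addn0 // => w; rewrite inE => /andP[wW wAR].
  apply: dg0 => y yR; apply: contra wW => hwy.
  by rewrite inE wAR; apply/existsP; exists y; rewrite yR.
have eqR : #|R|.*2 + n3 R = (nedges R).*2 + #|W|.
  rewrite -sum_dg // -crossAA -crossE -cR crossC.
  have eA : A = R :|: (A :\: R).
    by apply/setP=> x; rewrite !inE; case xR: (x \in R); rewrite //= (subsetP RA _ xR).
  have dis : [disjoint R & A :\: R].
    by rewrite -setI_eq0; apply/eqP/setP=> x; rewrite !inE; case: (x \in R).
  by rewrite {1}eA cross_union // [X in _ + X]crossC.
have nW : n3 W = #|W|.
  apply: eq_card => w; rewrite inE andb_idr // => /WP[_ _ -> _].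
  by rewrite eqxx.
have n3RW : n3 (R :|: W) = n3 R + #|W|.
  have := n3U R W; move: dRW; rewrite -setI_eq0 => /eqP->.
  have -> : n3 set0 = 0 by apply/eqP; rewrite cards_eq0; apply/eqP/setP=> x; rewrite !inE.
  by rewrite addn0 nW.
exists (R :|: W); split; last by rewrite n3RW; move: eqR eR; clear; lia.
split.
- by rewrite inE v0R.
- by rewrite subUset RA.
- rewrite nedges_union // EW addn0 cardsU; move: dRW; rewrite -setI_eq0 => /eqP->.
  by rewrite cards0 subn0 crossC cRW ltn_add2r.
- move=> z; rewrite inE => /orP[zR|/WP[wA wR w3 [x [xR hwx]]]].
    have [P [h1 h2 h3 h4 h5]] := arms z zR; exists P; split=> //.
      exact: subset_trans h3 (subsetUl _ _).
    exact: leqW.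
  have [P [h1 h2 h3 h4 h5]] := arms x xR; exists (z |: P).
  have wP : z \notin P by apply: contra wR; apply: (subsetP h3).
  split; rewrite ?inE ?eqxx ?h1 ?orbT //.
  + rewrite subUset sub1set (subset_trans h3 (subsetUl _ _)) andbT inE; apply/orP; right.
    by rewrite !inE wR wA; apply/existsP; exists x; rewrite xR.
  + rewrite nedges_add // cardsU1 wP.
    have : 0 < dg P z by apply/card_gt0P; exists x; rewrite inE h2.
    by move: h4; clear; lia.
  + by have := n3_add z P; rewrite w3 /=; move: h5; clear; lia.
Qed.

(** Growth as in the cubic tree: [3 * 2 ^ (s - 1) - 2] starts at 1 and satisfies the recursion
    [n -> 2 n + 2] of [ball_step]. *)
Lemma ball_exists s : 0 < s <= t ->
  exists R, [/\ ball R s,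
    forall w x, w \in A -> w \notin R -> x \in R -> h w x -> dg A w = 3 &
    3 * 2 ^ s.-1 <= n3 R + 2].
Proof.
case: s => // s /=; elim: s => [|s IH] st.
  have n1 : n3 [set v0] = 1.
    apply/eqP; rewrite -(cards1 v0); apply/eqP/eq_card=> x; rewrite !inE andb_idr //.
    by move/eqP->; rewrite v03.
  have e0 : nedges [set v0] = 0 by rewrite /nedges cross11.
  have b0 : ball [set v0] 1.
    split; rewrite ?set11 ?sub1set ?e0 ?cards1 //.
    by move=> w /set1P->; exists [set v0]; split; rewrite ?set11 ?cards1 ?e0 ?n1.
  have [R [s1 s2 s3]] := ball_close st b0; exists R; split=> //.
  by have := n3S s1; rewrite n1; clear; lia.
have [R [bR cR sR]] := IH (ltnW st).
have [R1 [bR1 sR1]] := @ball_step R s.+1 st bR cR.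
have [R2 [s1 s2 s3]] := ball_close st bR1; exists R2; split=> //.
by have := n3S s1; move: sR sR1; rewrite expnS; clear; lia.
Qed.

End Sparse.

(** Otherwise a ball with [s = t] would hold more vertices of degree 3 than [A] has. *)
Lemma small_cyclic_set : 0 < n3 A -> n3 A + 2 < 3 * 2 ^ t.-1 ->
  exists C, [/\ C \subset A, C != set0, #|C| <= nedges C & n3 C <= t.*2.-1].
Proof.
case/card_gt0P=> v0; rewrite inE => /andP[v0A /eqP v03] ub.
apply: contrapT => no.
have sparse C : C \subset A -> C != set0 -> n3 C <= t.*2.-1 -> nedges C < #|C|.
  by move=> *; rewrite ltnNge; apply/negP=> le; apply: no; exists C.
have [|R [[_ RA _ _] _]] := ball_exists sparse v0A v03 (s := t); first by rewrite t0 leqnn.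
by move/leq_trans/(_ (leq_add (n3S RA) (leqnn 2))); rewrite leqNgt ub.
Qed.

End SmallCyclicSet.

(** Deleting a set [C] with at least [#|C|] edges and at most [2 t - 1] vertices of degree 3 lowers
    the excess of edges over vertices by at most [2 t - 1], which leaves enough for the remaining
    cycles. [N] is fixed so that one [t] serves the whole induction. *)
Lemma disjoint_cycles t N n A : (forall x, dg setT x <= 3) -> 0 < t ->
  2 * (N * t.*2.-1) + 6 < 3 * 2 ^ t.-1 -> n <= N ->
  #|A| + (n * t.*2.-1).+1 <= nedges A ->
  exists cs, [/\ size cs = n.+1, all (is_cyc h) cs, uniq (flatten cs) &
    {subset flatten cs <= A}].
Proof.
move=> d3 t0 tN; elim: n A => [|n IH] A nN.
  rewrite mul0n => le; have [||c [cc cA]] := @set_cyc A.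
  - apply: contraTneq le => ->; rewrite /nedges crossE big_set0 cards0 //.
  - by move: le; clear; lia.
  exists [:: c]; rewrite /= cc cats0; split=> //.
  by case/and3P: cc.
move=> le; have A0 : A != set0.
  by apply: contraTneq le => ->; rewrite /nedges crossE big_set0 cards0.
have [B [BA B0 Bm hB]] := dense_core A0 le.
have d23 x : x \in B -> 2 <= dg B x <= 3.
  by case/hB => -> _; apply: leq_trans (d3 x); apply: dg_le.
have sB : \sum_(x in B) dg B x = #|B|.*2 + n3 B B by apply: sum_dg.
have eB : (nedges B).*2 = #|B|.*2 + n3 B B by rewrite -sB -crossE crossAA.
have [b bB] := set0Pn _ B0.
(* By minimality the excess of the core is at most [(n + 1) (2 t - 1) + 2]. Twice the excess is the
   number of vertices of degree 3, and [small_cyclic_set] asks for 2 more; hence the 6 in the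
   hypothesis on [t]. *)
have up : nedges B <= #|B| + (n.+1 * t.*2.-1).+1 + 1.
  have [_] := hB b bB; have /andP[_] := d23 b bB; clear; lia.
have [||C [CB C0 EC nC]] := @small_cyclic_set B t d23 t0.
- have aux (p q r m : nat) : q.*2 = p.*2 + r -> p + m.+1 <= q -> 0 < r by clear; lia.
  exact: aux eB Bm.
- apply: leq_trans tN; have : n.+1 * t.*2.-1 <= N * t.*2.-1 by rewrite leq_mul2r nN orbT.
  by move: eB up; clear; lia.
have [c [cc cC]] := set_cyc C0 EC.
have [||cs [s1 s2 s3 s4]] := IH (B :\: C); first exact: ltnW.
  have := nedges_split CB; rewrite (sum_dg d23) //.
  have := cardsID C B; rewrite (setIidPr CB).
  by move: Bm EC nC; rewrite mulSn; clear; lia.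
exists (c :: cs); rewrite /= s1 cc; split=> //.
  rewrite cat_uniq s3 andbT; apply/andP; split; first by case/and3P: cc.
  apply/hasPn=> x /s4; rewrite inE => /andP[xC _]; apply: contra xC; exact: cC.
move=> x; rewrite mem_cat => /orP[/cC /(subsetP CB)|/s4]; first exact: (subsetP BA).
by rewrite inE => /andP[_]; apply: (subsetP BA).
Qed.

End EdgeCount.

(** * Maximal subgraphs with degrees 2 and 3 *)

Section StepNeighbours.
Variable T : eqType.
Implicit Types (s : seq T) (a b c w : T).

Lemma step_head a b s w : uniq [:: a, b & s] -> step [:: a, b & s] a w = (w == b).
Proof.
move=> /= /andP[]; rewrite inE negb_or => /andP[/negPf ab na] _.
rewrite step_cons2 eqxx /= [b == a]eq_sym ab andbF /= [w == b]eq_sym orbC.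
case: (b == w); rewrite ?orbT // orbF; apply/negP=> /step_mem/andP[].
by rewrite inE ab (negPf na).
Qed.

Lemma step_inner s1 a b c s2 w : uniq (s1 ++ [:: a, b, c & s2]) ->
  step (s1 ++ [:: a, b, c & s2]) b w = (w == a) || (w == c).
Proof.
rewrite cat_uniq => /and3P[_ d u]; rewrite step_cat.
have ab : a != b by case/andP: u; rewrite inE negb_or => /andP[].
have -> : step (rcons s1 a) b w = false.
  apply/negP=> /step_mem/andP[]; rewrite mem_rcons inE eq_sym (negPf ab) /= => bs _.
  by case/hasP: d; exists b; rewrite // !inE eqxx orbT.
rewrite step_cons2 (negPf ab) /= eqxx andbT step_head; last by case/andP: u.
by rewrite [a == w]eq_sym.
Qed.

Lemma inner_split x s y b : b \in s ->
  exists s1 a c s2, x :: rcons s y = s1 ++ [:: a, b, c & s2].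
Proof.
case/splitPr=> t1 t2; rewrite rcons_cat rcons_cons -cat_cons lastI cat_rcons.
case: t2 => [|c t2]; first by exists (belast x t1), (last x t1), y, [::].
by exists (belast x t1), (last x t1), c, (rcons t2 y).
Qed.

Lemma path_dstep (e : rel T) a s :
  (forall u w, dstep (a :: s) u w -> e u w) -> path e a s.
Proof.
elim: s a => //= b s IH a H; apply/andP; split; first by apply: H; rewrite !eqxx.
by apply: IH => u w /= h; apply: H; rewrite h orbT.
Qed.

Lemma cstep_at b s : 1 < size s -> uniq (b :: s) ->
  head b s != last b s /\ forall w, cstep (b :: s) b w = (w == head b s) || (w == last b s).
Proof.
case: s => // a s; case: (lastP s) => // {}s d _ u.
rewrite [head _ _]/= [last _ _]/= last_rcons; split.
  by move: u => /= /and3P[_ + _]; rewrite mem_rcons inE negb_or => /andP[].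
move=> w; rewrite -[_ :: _ :: _]/(b :: [::] ++ a :: rcons s d) cstep_split.
congr (_ || _).
  by rewrite step_head //; move: u => /= /andP[+ _]; rewrite !inE negb_or andbT => /andP[].
rewrite -step_rev rev_cons !rev_rcons /= step_head //.
have : uniq (rcons (a :: rcons s d) b) by rewrite rcons_uniq.
by rewrite -rev_uniq rev_rcons rev_cons rev_rcons.
Qed.

Lemma cyc_nbrs (C : seq T) b : 2 < size C -> uniq C -> b \in C ->
  exists a d, a != d /\ forall w, cstep C b w = (w == a) || (w == d).
Proof.
move=> sc uc /rot_to[i s e].
have ur : uniq (b :: s) by rewrite -e rot_uniq.
have ss : 1 < size s by have := size_rot i C; rewrite e /= => h; move: sc; rewrite -h.
have [hl H] := cstep_at ss ur; exists (head b s), (last b s); split=> // w.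
by rewrite -(cstep_rot i) e.
Qed.

Lemma step_closed (P : pred T) a s : P a ->
  (forall z y, step (a :: s) z y -> P z -> P y) -> all P (a :: s).
Proof.
elim: s a => [|b s IH] a Pa H; first by rewrite /= Pa.
rewrite [all _ _]/= Pa /=; apply: IH; first by apply: H Pa; rewrite step_cons2 !eqxx.
by move=> z y zy; apply: H; rewrite step_cons2 zy !orbT.
Qed.

(* A simple path and a simple walk that starts with the same edge agree as
   long as the inner vertices of the path have no other neighbours. *)
Lemma follow (e : rel T) a b t s : path e a (b :: t) -> uniq [:: a, b & t] ->
  (forall s1 u v w s2, [:: a, b & s] = s1 ++ [:: u, v, w & s2] ->
     forall z, e v z -> z = u \/ z = w) ->
  (exists t', t = s ++ t') \/ (exists w s', s = t ++ w :: s').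
Proof.
elim: t a b s => [|d t IH] a b [|f s] //=.
- by move=> _ _ _; left; exists [::].
- by move=> _ _ _; right; exists f, s.
- by move=> _ _ _; left; exists (d :: t).
move=> /and3P[eab ebd pt] /andP[nad u] H.
have df : d = f.
  case: (H [::] a b f s erefl d ebd) => // da.
  by move: nad; rewrite da !inE eqxx orbT.
rewrite -df in H *; case: (IH b d s) => //=.
- by rewrite ebd.
- move=> s1 u' v w s2 E; apply: (H (a :: s1) u' v w s2).
  by rewrite /= E.
- by case=> t' ->; left; exists t'.
- by case=> w [s' ->]; right; exists w, s'.
Qed.

End StepNeighbours.

Section MaximalSubgraph.
Variables (V : finType) (g : rel V) (l : nat).
Hypotheses (gS : symmetric g) (gI : irreflexive g) (l3 : 2 < l).
Implicit Types (c s : seq V) (x y u v w : V) (h : rel V).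

Definition deg h x := #|[set y | h x y]|.

(** Degree 0 means outside the subgraph, which is thus a mere relation on [V]. *)
Definition good h := [/\ symmetric h, subrel h g,
  (forall x, deg h x \in [:: 0; 2; 3]) & forall c, is_cyc h c -> l <= size c].

Definition maximal_good h := good h /\
  forall h', good h' -> subrel h h' -> subrel h' h.

Lemma degS h h' x : subrel h h' -> deg h x <= deg h' x.
Proof. by move=> s; apply: subset_leq_card; apply/subsetP=> y; rewrite !inE => /s. Qed.

Lemma exists_maximal_good : exists h, maximal_good h.
Proof.
pose P n := `[< exists h, good h /\ \sum_x deg h x = n >].
have e0 x : deg (fun _ _ => false) x = 0.
  by apply/eqP; rewrite cards_eq0; apply/eqP/setP=> y; rewrite !inE.
have exP : exists n, P n.
  exists 0; apply/asboolP; exists (fun _ _ => false); split.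
    split=> // [x|c]; first by rewrite e0.
    by case/and3P; case: c => // a [].
  by apply: big1 => x _; apply: e0.
have bdP n : P n -> n <= \sum_(x : V) #|V|.
  by case/asboolP=> h [_ <-]; apply: leq_sum => x _; apply: max_card.
case: (ex_maxnP exP bdP) => n /asboolP[h [gh sh]] mx.
exists h; split=> // h' gh' hh' x y h'xy; apply: contraT => nxy.
have : P (\sum_x deg h' x) by apply/asboolP; exists h'.
move/mx; rewrite leqNgt -sh => /negP[].
rewrite (bigD1 x) //= [X in _ < X](bigD1 x) //= -addSn leq_add //.
  apply: proper_card; apply/properP; split; first by apply/subsetP=> z; rewrite !inE => /hh'.
  by exists y; rewrite inE.
by apply: leq_sum => z _; apply: degS.
Qed.

Variable h : rel V.
Hypothesis hmax : maximal_good h.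

Lemma maxS : symmetric h. Proof. by case: hmax => [[]]. Qed.
Lemma max_sub : subrel h g. Proof. by case: hmax => [[]]. Qed.
Lemma maxI : irreflexive h. Proof. by move=> x; apply/negP=> /max_sub; rewrite gI. Qed.
Lemma max_long c : is_cyc h c -> l <= size c. Proof. by case: hmax => [[_ _ _ H]] _; apply: H. Qed.
Lemma max_deg x : deg h x \in [:: 0; 2; 3]. Proof. by case: hmax => [[]]. Qed.

Lemma deg0P x y : deg h x = 0 -> h x y = false.
Proof.
by move=> /eqP; rewrite cards_eq0 => /eqP/setP/(_ y); rewrite !inE.
Qed.

Lemma deg0P' x y : deg h x = 0 -> h y x = false.
Proof. by rewrite maxS; apply: deg0P. Qed.

Lemma sub_is_cyc (e e' : rel V) c : subrel e e' -> is_cyc e c -> is_cyc e' c.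
Proof. by move=> s /and3P[h1 h2 h3]; rewrite /is_cyc h1 h3 (sub_cycle s h2). Qed.

Lemma cycle_cstep (e : rel V) c : symmetric e -> 2 < size c -> uniq c ->
  is_cyc e c \/ exists a b, cstep c a b /\ ~~ e a b.
Proof.
move=> eS sc uc; have [[a [b ab]]|no] := pselect (exists a b, cstep c a b /\ ~~ e a b).
  by right; exists a, b.
left; rewrite /is_cyc sc uc andbT /=; case: c no {sc uc} => //= a c no.
apply: path_dstep => u w d; apply: contraT => n; case: no; exists u, w.
by rewrite /step d.
Qed.

(** Otherwise [C] could be added to [h]: its vertices have no other neighbours in the enlarged
    graph, so a cycle using an edge of [C] contains all of [C] and is long. *)
Lemma disjoint_long_cycle C : is_cyc g C -> l <= size C ->
  (forall z, z \in C -> deg h z = 0) -> False.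
Proof.
move=> cC lC dC; pose h' x y := h x y || cstep C x y.
have /and3P[sC _ uC] := cC.
have nbr z : z \in C -> exists a d, [/\ a != d, cstep C z a, cstep C z d &
    [set y | h' z y] = [set a; d]].
  move=> zC; have [a [d [ad H]]] := cyc_nbrs sC uC zC.
  exists a, d; split=> //; rewrite ?H ?eqxx ?orbT //.
  by apply/setP=> y; rewrite !inE /h' deg0P ?dC // H.
have good' : good h'.
  split.
  - by move=> x y; rewrite /h' maxS cstepC.
  - by move=> x y /orP[/max_sub//|]; apply: is_cyc_step.
  - move=> x; have [xC|xC] := boolP (x \in C).
      by have [a [d [ad _ _ e]]] := nbr x xC; rewrite /deg e cards2 ad.
    rewrite (_ : deg h' x = deg h x) ?max_deg //; apply: eq_card => y.
    rewrite !inE /h'; case: (boolP (cstep C x y)) => [/cstep_mem|_]; last by rewrite orbF.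
    by rewrite (negPf xC).
  - move=> c cc; have /and3P[sc _ uc] := cc.
    case: (cycle_cstep maxS sc uc) => [|[a [b [ab nab]]]]; first exact: max_long.
    have h'ab : h' a b.
      have h'S : symmetric h' by move=> x y; rewrite /h' maxS cstepC.
      exact: is_cyc_step cc ab.
    have Cab : cstep C a b by move: h'ab; rewrite /h' (negPf nab).
    have /andP[aC _] := cstep_mem Cab; have /andP[ac _] := cstep_mem ab.
    have clos z y : z \in C -> z \in c -> cstep C z y -> y \in c.
      move=> zC zc zy; have [p [q [pq H]]] := cyc_nbrs sc uc zc.
      have [a' [d' [ad' _ _ e]]] := nbr z zC.
      have h'S : symmetric h' by move=> x1 y1; rewrite /h' maxS cstepC.
      have /eqP e' : [set p; q] == [set a'; d'].
        rewrite eqEcard !cards2 pq ad' andbT -e; apply/subsetP=> w; rewrite in_set2 -H inE => /(is_cyc_step h'S cc) //.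
      have : y \in [set p; q] by rewrite e' -e inE /h' zy orbT.
      by rewrite in_set2 -H => /cstep_mem/andP[].
    apply: leq_trans lC _; apply: uniq_leq_size => //.
    have [s [cD _ mD eD]] := cyc_at cC aC.
    move=> z; rewrite -mD => zs.
    have /allP : all [in c] (rcons (a :: s) a).
      apply: step_closed => // z' y; rewrite -/(cstep (a :: s) z' y) eD => zy.
      by have /andP[zC _] := cstep_mem zy; move/(clos _ _ zC); apply.
    by apply; rewrite mem_rcons inE zs orbT.
have [a aC] : exists a, a \in C by case: (C) sC => // a s _; exists a; rewrite inE eqxx.
have [b [_ [_ Cab _ _]]] := nbr a aC.
have : h a b by apply: (proj2 hmax h' good') => [x y hxy|]; rewrite /h' ?hxy ?Cab ?orbT.
by rewrite deg0P // dC.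
Qed.

(** * Ears between vertices of degree 2 *)

Section Ear.
Variables (x y : V) (s : seq V).
Hypotheses (dx : deg h x = 2) (dy : deg h y = 2) (ds : forall z, z \in s -> deg h z = 0).
Hypotheses (uQ : uniq (x :: rcons s y)) (pQ : path g x (rcons s y)).
Hypothesis newQ : s != [::] \/ ~~ h x y.

Let Q := x :: rcons s y.
Let h' u w := h u w || step Q u w.

Let h'S : symmetric h'.
Proof. by move=> u w; rewrite /h' maxS stepC. Qed.

Let xs : x \notin s.
Proof. by apply/negP=> /ds; rewrite dx. Qed.

Let ys : y \notin s.
Proof. by apply/negP=> /ds; rewrite dy. Qed.

Let xy : x != y.
Proof. by move: uQ; rewrite /= mem_rcons inE negb_or => /andP[/andP[]]. Qed.

Let headQ w : step Q x w = (w == head y s).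
Proof. by rewrite /Q; case: (s) uQ => [|b s'] u; rewrite step_head. Qed.

Let lastQ w : step Q y w = (w == last x s).
Proof.
have E : rev Q = y :: rev (x :: s) by rewrite /Q -rcons_cons rev_rcons.
rewrite -step_rev E; have : uniq (y :: rev (x :: s)) by rewrite -E rev_uniq.
by case: (lastP s) => [|s' b]; rewrite ?rev_cons ?rev_rcons /= ?last_rcons => u; rewrite step_head.
Qed.

Let innerQ z : z \in s -> exists a d, [/\ a != d, step Q z a, step Q z d &
  forall w, h' z w = (w == a) || (w == d)].
Proof.
move=> zs; have [s1 [a [d [s2 E]]]] := inner_split x y zs.
have u := uQ; rewrite E in u.
have H w : step Q z w = (w == a) || (w == d) by rewrite /Q E step_inner.
exists a, d; split; rewrite ?H ?eqxx ?orbT //.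
  move: u; rewrite cat_uniq => /and3P[_ _ /andP[+ _]].
  by rewrite !inE !negb_or => /and3P[].
by move=> w; rewrite /h' deg0P ?ds // H.
Qed.

Let new_step u w : ~~ h u w -> h' u w -> step Q u w.
Proof. by rewrite /h' => /negPf->. Qed.

Let good_if : (forall c, is_cyc h' c -> l <= size c) -> False.
Proof.
move=> lg; have gd : good h'.
  split=> //.
  - by move=> u w /orP[/max_sub//|]; apply: step_path.
  - move=> z; have [zs|zs] := boolP (z \in s).
      have [a [d [ad _ _ H]]] := innerQ zs; rewrite /deg.
      rewrite (_ : [set _ | _] = [set a; d]) ?cards2 ?ad //.
      by apply/setP=> w; rewrite !inE H.
    have [zx|zx] := eqVneq z x; [|have [zy|zy] := eqVneq z y].
    + have nh : ~~ h x (head y s).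
        case: s newQ ds => [|b s'] /=; first by case.
        by move=> _ /(_ b (mem_head _ _)) /deg0P' ->.
      rewrite zx /deg (_ : [set _ | _] = head y s |: [set w | h x w]).
        by rewrite cardsU1 inE nh -/(deg h x) dx.
      by apply/setP=> w; rewrite !inE /h' headQ orbC.
    + have nh : ~~ h y (last x s).
        case: (lastP s) newQ ds => [|s' b] /=; first by case=> //; rewrite maxS.
        move=> _ /(_ b); rewrite mem_rcons inE eqxx last_rcons => /(_ isT) /deg0P' ->.
        by [].
      rewrite zy /deg (_ : [set _ | _] = last x s |: [set w | h y w]).
        by rewrite cardsU1 inE nh -/(deg h y) dy.
      by apply/setP=> w; rewrite !inE /h' lastQ orbC.
    + rewrite (_ : deg h' z = deg h z) ?max_deg //; apply: eq_card => w; rewrite !inE /h'.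
      case: (boolP (step Q z w)) => [/step_mem/andP[+ _]|_]; last by rewrite orbF.
      by rewrite inE mem_rcons inE (negPf zx) (negPf zy) (negPf zs).
have hh' : subrel h h' by move=> u w; rewrite /h' => ->.
have := proj2 hmax h' gd hh' x (head y s); rewrite /h' headQ eqxx orbT => /(_ isT).
case: s newQ ds => [|b s'] /=; first by case=> // /negPf->.
by move=> _ /(_ b (mem_head _ _)) /deg0P' ->.
Qed.

(** Adding the ear [Q] keeps the degrees in 0, 2, 3, so by maximality it creates a short cycle. This
    cycle uses an edge of [Q], hence all of [Q], whose inner vertices have degree 2 in [h']; the
    rest of it is a path of [h]. *)
Lemma ear_short : exists t, [/\ is_cyc g (x :: s ++ y :: t),
  size (x :: s ++ y :: t) < l & path h y (rcons t x)].
Proof.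
apply: contrapT => no; apply: good_if => c cc; rewrite leqNgt; apply/negP=> lc; apply: no.
have /and3P[sc _ uc] := cc.
have h'g : subrel h' g by move=> u w /orP[/max_sub//|]; apply: step_path.
have h'I : irreflexive h' by move=> z; apply/negP=> /h'g; rewrite gI.
have inner s1 u v w s2 : Q = s1 ++ [:: u, v, w & s2] ->
    forall z, h' v z = (z == u) || (z == w).
  move=> E z; have uE := uQ; rewrite -/Q E in uE.
  have H z' : step Q v z' = (z' == u) || (z' == w) by rewrite E step_inner.
  have uw : u != w.
    move: uE; rewrite cat_uniq => /and3P[_ _ /andP[+ _]].
    by rewrite !inE !negb_or => /and3P[].
  have : v \in Q by rewrite E mem_cat !inE eqxx !orbT.
  have two f : (forall z', step Q v z' = (z' == f)) -> False.
    move=> F; have := H u; have := H w; rewrite !eqxx orbT !F => /eqP ew /eqP eu.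
    by rewrite eu ew eqxx in uw.
  rewrite inE mem_rcons inE => /or3P[/eqP e|/eqP e|vs].
  - by case: (two (head y s)) => z'; rewrite e headQ.
  - by case: (two (last x s)) => z'; rewrite e lastQ.
  by rewrite /h' deg0P ?ds //= H.
have back s1 : forall a b s2, Q = s1 ++ [:: a, b & s2] -> cstep c a b ->
    cstep c x (head y s).
  elim/last_ind: s1 => [|s1 z IH] a b s2 E cab.
    by move: E; rewrite /Q => -[-> E]; case: (s) E => [|? ?] [->].
  rewrite cat_rcons in E; apply: (IH z a (b :: s2) E).
  have /andP[ac _] := cstep_mem cab.
  have [p [q [pq H]]] := cyc_nbrs sc uc ac.
  have hp : h' a p by apply: is_cyc_step cc _ => //; rewrite H eqxx.
  have hq : h' a q by apply: is_cyc_step cc _ => //; rewrite H eqxx orbT.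
  rewrite cstepC H; move: hp hq pq; rewrite !(inner _ _ _ _ _ E).
  case/orP=> /eqP-> /orP[]/eqP->; rewrite ?eqxx ?orbT //.
have [cx|[a [b [cab nab]]]] := cycle_cstep maxS sc uc.
  by have := max_long cx; rewrite leqNgt lc.
have cxq : cstep c x (head y s).
  have := new_step nab (is_cyc_step h'S cc cab).
  case/orP=> /dstep_split[s1 [s2 E]]; first exact: back E cab.
  by apply: back E _; rewrite cstepC.
have [t sct] := cyc_edge h'S h'I cc cxq.
have [ct szt _ _] := sct; have /and3P[s_t pt ut] := ct.
have eQ : Q = [:: x, head y s & behead (rcons s y)] by rewrite /Q; case: (s).
have ptt : path h' x (head y s :: t).
  by move: pt; rewrite /= rcons_path => /and3P[-> ->].
have uQ2 : forall s1 u v w s2, [:: x, head y s & behead (rcons s y)] = s1 ++ [:: u, v, w & s2] ->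
     forall z, h' v z -> z = u \/ z = w.
  move=> s1 u v w s2; rewrite -eQ => E z; rewrite (inner _ _ _ _ _ E).
  by case/orP=> /eqP->; [left|right].
(* The cycle and [Q] start with the same edge. If the cycle ended first, it would return to [x] from
   an inner vertex of [Q]. *)
case: (follow ptt ut uQ2) => [[J eJ]|[w [s' es]]]; last first.
  exfalso; case: (lastP t) => [|t1 v] in es ct s_t pt ut ptt *; first by [].
  have E : Q = belast x (head y s :: t1) ++ [:: last (head y s) t1, v, w & s'].
    by rewrite eQ es cat_rcons -[LHS]/((x :: head y s :: t1) ++ _) lastI cat_rcons.
  have : h' v x by move: pt; rewrite /= rcons_path last_rcons => /andP[_ /andP[]].
  rewrite (inner _ _ _ _ _ E) => /orP[/eqP e|/eqP e].
    move: ut => /= /andP[]; rewrite {1}e -rcons_cons mem_rcons inE.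
    by rewrite mem_last orbT.
  have := uQ; rewrite -/Q E /= => /andP[].
  by rewrite mem_cat !inE -e eqxx !orbT.
have eC : [:: x, head y s & t] = x :: s ++ y :: J.
  by rewrite eJ -cat_rcons; case: (s).
rewrite eC in ct szt ut; exists J; split; first exact: sub_is_cyc h'g ct.
  by rewrite szt.
have pJ : path h' y (rcons J x).
  by have /and3P[_ + _] := ct; rewrite /= rcons_cat rcons_cons cat_path /= => /and3P[].
have [yJ xJ dJ] : [/\ y \notin J, x \notin J & forall z, z \in J -> z \notin s].
  move: ut; rewrite /= mem_cat inE !negb_or cat_uniq /=.
  case/andP=> /and3P[_ _ ->] /and3P[_ /norP[_ d] /andP[-> _]]; split=> // z zJ.
  by apply: contra d => zs; apply/hasP; exists z.
apply: path_dstep => u w d; apply: contraT => nuw; exfalso.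
have h'uw : h' u w by apply: (dstep_path pJ d).
have suw := new_step nuw h'uw.
(* An edge of [Q] on the rest of the cycle can only join [x] and [y]; then [s] is empty and the
   cycle would use [x y] twice. *)
have ends z : z \in y :: rcons J x -> z \in Q -> z = x \/ z = y.
  rewrite /Q !(inE, mem_rcons) => /or3P[/eqP|/eqP|zJ]; [by right|by left|].
  by rewrite (negPf (dJ z zJ)) orbF => /orP[]/eqP; [left|right].
have /andP[uQ' wQ'] := step_mem suw.
have /andP[uJ' wJ'] := dstep_mem d.
have uw : u != w by apply: contraTneq h'uw => ->; rewrite h'I.
have {d} d : step (y :: rcons J x) u w by rewrite /step d.
have [Qxy Jxy] : step Q x y /\ step (y :: rcons J x) y x.
  case: (ends u uJ' uQ') (ends w wJ' wQ') suw d uw => -> [] -> suw d; rewrite ?eqxx //.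
  - by split=> //; rewrite stepC.
  - by split=> //; rewrite stepC.
move: Qxy; rewrite headQ => Qxy.
have s0 : s = [::] by case: (s) Qxy ys => //= q s1 /eqP->; rewrite inE eqxx.
case: J {eJ eC pJ ends uJ' wJ' d} ct szt ut yJ xJ dJ Jxy => [|j J] ct szt ut yJ xJ dJ.
  by move: ct; rewrite s0 => /and3P[].
rewrite rcons_cons step_head; first by rewrite inE negb_or in xJ; case/andP: xJ => /negPf->.
rewrite -!rcons_cons rcons_uniq inE negb_or xy xJ /=.
by move: ut; rewrite s0 => /= /andP[].
Qed.

End Ear.

End MaximalSubgraph.

(** * Long cycles and class changes *)

Section Separation.
Variables (V : finType) (g : rel V) (l : nat).
Hypotheses (gS : symmetric g) (gI : irreflexive g) (l3 : 2 < l).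
Hypothesis gap : forall c, is_cyc g c -> size c < l \/ l.*2 < size c.
Variable h : rel V.
Hypothesis hmax : maximal_good g l h.
Implicit Types (c s t m : seq V) (x y u v w z p : V).

Notation tied := (tied g l).
Let hS := maxS hmax.
Let hI := maxI gI hmax.
Let ttrans := tied_trans gS gI gap.

Lemma deg2P z a b w : deg h z = 2 -> h z a -> h z b -> a != b -> h z w -> w = a \/ w = b.
Proof.
move=> dz za zb ab zw.
have /eqP e : [set a; b] == [set y | h z y].
  rewrite eqEcard -[X in X <= _]/(deg h z) dz cards2 ab andbT.
  by apply/subsetP=> y /set2P[]->; rewrite inE.
have : w \in [set a; b] by rewrite e inE.
by case/set2P; [left|right].
Qed.

(** The shadow of an excursion: a path of [h] in one class whose end edges are tied to those of the
    excursion. It is the rest of the short cycle from [ear_short], or the given edge itself if that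
    already lies in [h]. *)
Lemma link x s y : deg h x = 2 -> deg h y = 2 -> (forall z, z \in s -> deg h z = 0) ->
  uniq (x :: rcons s y) -> path g x (rcons s y) ->
  exists t, [/\ path h x (rcons t y), uniq (x :: rcons t y),
    forall a b u w, step (x :: rcons t y) a b -> step (x :: rcons t y) u w -> tied a b u w,
    tied x (head y s) x (head y t) & tied y (last x s) y (last x t)].
Proof.
move=> dx dy ds us ps.
have [[s0 hxy]|new] : (s = [::] /\ h x y) \/ (s != [::] \/ ~~ h x y).
  by case: (eqVneq s [::]) => [->|]; [case: (h x y)|]; auto.
  exists [::]; rewrite s0 /= in us *; split=> //.
  - by rewrite hxy.
  - move=> a b u w; rewrite !step_cons2 [step [:: y] _ _]/= !orbF.
    by case/orP=> /andP[/eqP<- /eqP<-] /orP[]/andP[/eqP<- /eqP<-]; left; rewrite /same_edge !eqxx ?orbT.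
  - exact: tied_refl.
  - exact: tied_refl.
have [J [cS sS pJ]] := ear_short gS gI hmax dx dy ds us ps new.
have /and3P[_ _ uS] := cS.
have st a b : step (x :: rcons (rev J) y) a b -> cstep (x :: s ++ y :: J) a b.
  by rewrite cstep_split -[_ || step (y :: _) _ _]orbC -(step_rev (y :: _)) rev_cons rev_rcons => ->.
have sq a b : step (x :: rcons s y) a b -> cstep (x :: s ++ y :: J) a b.
  by rewrite cstep_split => ->.
have headS u w (q : seq V) : step (u :: rcons q w) u (head w q).
  by case: q => [|? ?]; rewrite /= step_cons2 !eqxx.
have lastS u w (q : seq V) : step (u :: rcons q w) w (last u q).
  have := headS w u (rev q); rewrite -step_rev rev_cons rev_rcons revK.
  by case: (lastP q) => [|q' r]; rewrite ?rev_rcons ?last_rcons.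
exists (rev J); split.
- by rewrite -path_revS.
- have : uniq (rev (x :: rcons (rev J) y)).
    rewrite rev_cons rev_rcons revK -rot1_cons rot_uniq -[x :: y :: J]/([:: x] ++ _).
    apply: subseq_uniq uS; rewrite -[x :: s ++ _]/([:: x] ++ s ++ _).
    by rewrite subseq_cat2l suffix_subseq.
  by rewrite rev_uniq.
- by move=> a b u w /st h1 /st h2; apply: tied_cyc cS _ _ _.
- by apply: tied_cyc cS sS _ _; [apply: sq|apply: st].
- by apply: tied_cyc cS sS _ _; [apply: sq|apply: st].
Qed.

Lemma first_link p s : deg h p = 2 -> is_cyc g (p :: s) -> has (fun z => deg h z != 0) s ->
  (forall z, z \in s -> deg h z != 0 -> deg h z = 2) ->
  exists y s1 s2 t, [/\ s = s1 ++ y :: s2, deg h y = 2, path h p (rcons t y) &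
    [/\ uniq (p :: rcons t y),
    forall a b u w, step (p :: rcons t y) a b -> step (p :: rcons t y) u w -> tied a b u w
    & tied p (head p s) p (head y t)]].
Proof.
move=> dp /and3P[_ pc uc] hs ds; have [s1 [y [s2 [es dy ns1]]]] := split_first hs.
have ds0 z : z \in s1 -> deg h z = 0.
  by move=> zs; apply/eqP; apply: contraNT ns1 => dz; apply/hasP; exists z.
have dy2 : deg h y = 2 by apply: ds => //; rewrite es mem_cat inE eqxx orbT.
rewrite es in pc uc *.
have us' : uniq (p :: rcons s1 y).
  have : uniq ((p :: rcons s1 y) ++ s2) by rewrite /= cat_rcons.
  by rewrite cat_uniq => /andP[].
have ps1 : path g p (rcons s1 y).
  by move: pc; rewrite /= rcons_cat rcons_cons -cat_rcons cat_path => /andP[].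
have [t [pt ut Ht th _]] := link dp dy2 ds0 us' ps1.
by exists y, s1, s2, t; split=> //; split=> //; case: (s1) th.
Qed.

Definition transition p := deg h p = 2 /\
  forall a b, h p a -> h p b -> a != b -> ~ tied p a p b.

(** * Walks caught between two transitions *)

Section Trap.
Variables (p v : V) (m : seq V).
Hypotheses (tp : transition p) (tv : transition v).
Hypotheses (pm : path h p (rcons m v)) (um : uniq (p :: rcons m v)).
Hypothesis dm : forall z, z \in m -> deg h z = 2.

Let n1 := head v m.

Lemma trap_closed z w : z \in m -> h z w -> w \in p :: rcons m v.
Proof.
move=> zm zw; have [s1 [a [c [s2 E]]]] := inner_split p v zm.
have sE a' b' : step (p :: rcons m v) a' b' -> h a' b' by apply: step_path.
have uE := um; rewrite E in uE.
have ac : a != c.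
  move: uE; rewrite cat_uniq => /and3P[_ _ /andP[+ _]].
  by rewrite !inE !negb_or => /and3P[].
have [ha hc] : h z a /\ h z c by split; apply: sE; rewrite E step_inner // eqxx ?orbT.
by case: (deg2P (dm zm) ha hc ac zw) => ->; rewrite E mem_cat !inE eqxx !orbT.
Qed.

Lemma trap_nbr w : h p w -> w \in m -> w = n1.
Proof.
move=> hpw wm; have [s1 [a [c [s2 E]]]] := inner_split p v wm.
have sE a' b' : step (p :: rcons m v) a' b' -> h a' b' by apply: step_path.
have uE := um; rewrite E in uE.
have [aw ac] : a != w /\ a != c.
  move: uE; rewrite cat_uniq => /and3P[_ _ /andP[+ _]].
  by rewrite !inE !negb_or => /and3P[].
have [ha hc] : h w a /\ h w c by split; apply: sE; rewrite E step_inner // eqxx ?orbT.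
rewrite hS in hpw; case: (deg2P (dm wm) ha hc ac hpw) => e.
  case: s1 E uE => [|q s1] E uE.
    by move: E; rewrite /n1; case: (m) => [|? ?] [_ -> ].
  by move: uE; case: E => <- _ /=; rewrite e mem_cat !inE eqxx !orbT.
have : p \in rcons m v.
  case: s1 E uE => [|q s1] [E1 E2] uE; first by rewrite E2 e !inE eqxx orbT.
  by rewrite E2 e mem_cat !inE eqxx !orbT.
by move: um => /= /andP[/negPf->].
Qed.

(** The only ways out of [m] lead through [p] or [v], where the class changes, so a path in one
    class can at most end there. *)
Lemma trap z s : z \in m -> path h z s -> uniq (z :: s) ->
  (forall a b u w, step (z :: s) a b -> step (z :: s) u w -> tied a b u w) ->
  all [in m] (belast z s) /\ last z s \in p :: rcons m v.
Proof.
elim: s z => [|w s IH] z zm /=; first by rewrite inE mem_rcons inE zm !orbT.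
move=> /andP[zw ps] /andP[zs us] H; rewrite zm /=.
have H' a b u w' : step (w :: s) a b -> step (w :: s) u w' -> tied a b u w'.
  by move=> h1 h2; apply: H; rewrite step_cons2 ?h1 ?h2 !orbT.
have wN := trap_closed zm zw.
have [wm|wm] := boolP (w \in m); first exact: IH.
have tw : transition w.
  by move: wN; rewrite inE mem_rcons inE (negPf wm) orbF => /orP[]/eqP->.
case: s ps us zs H {IH H'} => [//|w' s] ps us zs H; exfalso.
case: tw => _ /(_ z w'); apply.
- by rewrite hS.
- by case/andP: ps.
- by move: zs; rewrite !inE !negb_or => /and3P[].
- by apply: H; rewrite !step_cons2 !eqxx ?orbT.
Qed.

Lemma trap_start s : path h p s -> uniq (p :: s) -> head p s = n1 -> s != [::] ->
  (forall a b u w, step (p :: s) a b -> step (p :: s) u w -> tied a b u w) ->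
  last p s \in rcons m v.
Proof.
case: s => // w s /= /andP[pw ps] /andP[nps us] wn _ H.
have H' a b u w' : step (w :: s) a b -> step (w :: s) u w' -> tied a b u w'.
  by move=> h1 h2; apply: H; rewrite step_cons2 ?h1 ?h2 !orbT.
have [wm|wm] := boolP (w \in m).
  have [_] := trap wm ps us H'; rewrite inE => /orP[/eqP e|//].
  by move: nps; rewrite -e mem_last.
have wv : w = v.
  by move: wm; rewrite wn /n1; case: (m) => //= b m'; rewrite inE eqxx.
case: s ps us nps H {H'} => [|w' s] ps us nps H; first by rewrite wv mem_rcons inE eqxx.
exfalso; case: tv => _; rewrite -wv => /(_ p w'); apply.
- by rewrite hS.
- by case/andP: ps.
- by move: nps; rewrite !inE !negb_or => /and3P[].
- by apply: H; rewrite !step_cons2 !eqxx ?orbT.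
Qed.

(** The shadow of each excursion stays in [m], so the walk meets [h] in [m] again and again until it
    returns to [p]; and [n1] is the only neighbour of [p] in [m]. *)
Lemma trap_walk y s : y \in m -> path g y (rcons s p) ->
  uniq (p :: y :: s) -> v \notin s -> (forall z, z \in s -> deg h z != 0 -> deg h z = 2) ->
  tied p (last y s) p n1.
Proof.
have [n] := ubnP (size s); elim: n y s => // n IH y s sn ym ps us vs ds.
have [hs|hs] := boolP (has (fun z => deg h z != 0) s); last first.
  have ds0 z : z \in s -> deg h z = 0.
    by move=> zs; apply/eqP; apply: contraNT hs => dz; apply/hasP; exists z.
  have [|t [pt ut Ht _ tl]] := link (dm ym) (proj1 tp) ds0 _ ps.
    by rewrite -rcons_cons rcons_uniq.
  have [am _] := trap ym pt ut Ht.
  have lm : last y t \in m.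
    by apply: (allP am); rewrite belast_rcons mem_last.
  suff -> : n1 = last y t by exact: tl.
  apply/esym/trap_nbr => //; rewrite hS.
  by move: pt; rewrite rcons_path => /andP[].
have [s1 [y' [s2 [es dy' ns1]]]] := split_first hs.
have ds0 z : z \in s1 -> deg h z = 0.
  by move=> zs; apply/eqP; apply: contraNT ns1 => dz; apply/hasP; exists z.
rewrite es in sn ps us vs ds *.
have y's : y' \in s1 ++ y' :: s2 by rewrite mem_cat inE eqxx orbT.
have us' : uniq (y :: rcons s1 y').
  have : uniq ((y :: rcons s1 y') ++ s2) by rewrite /= cat_rcons; case/andP: us.
  by rewrite cat_uniq => /andP[].
have [ps1 ps2] : path g y (rcons s1 y') /\ path g y' (rcons s2 p).
  by move: ps; rewrite rcons_cat rcons_cons -cat_rcons cat_path last_rcons => /andP[].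
have [t [pt ut Ht _ _]] := link (dm ym) (ds y' y's dy') ds0 us' ps1.
have [_] := trap ym pt ut Ht; rewrite last_rcons inE mem_rcons inE.
have /negPf-> : y' != p.
  by apply: contraTneq us => e; rewrite -e /= inE y's orbT.
have /negPf-> : y' != v by apply: contraNneq vs => <-.
rewrite /= last_cat /= => y'm; apply: IH => //.
- by move: sn; rewrite size_cat /=; clear; lia.
- apply: subseq_uniq us; rewrite -[p :: y :: _]/([:: p] ++ (y :: s1) ++ y' :: s2).
  by rewrite -[p :: y' :: _]/([:: p] ++ _) subseq_cat2l suffix_subseq.
- by apply: contra vs; rewrite mem_cat inE => ->; rewrite !orbT.
- by move=> z zs; apply: ds; rewrite mem_cat inE zs !orbT.
Qed.

(** Leaving [p] in the class of [p n1], the cycle is caught in [m]; as it avoids [v], it can only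
    come back to [p] in the same class. *)
Lemma trap_side s : is_cyc g (p :: s) -> has (fun z => deg h z != 0) s ->
  (forall z, z \in s -> deg h z != 0 -> deg h z = 2) -> v \notin s ->
  tied p (head p s) p n1 -> tied p (last p s) p n1.
Proof.
move=> cs hs ds vs tn.
have [y [s1 [s2 [t [es dy pt [ut Ht th]]]]]] := first_link (proj1 tp) cs hs ds.
have hn1 : h p n1 by move: pm; rewrite /n1; case: (m) => /= [|b m'] /andP[].
have hn : h p (head y t) by case: (t) pt => /= [|b t'] /andP[].
have e : head y t = n1.
  apply/eqP; apply: contraT => ne; case: tp => _ /(_ _ _ hn hn1 ne); case.
  by apply: ttrans tn; apply: tied_sym.
have : last p (rcons t y) \in rcons m v.
  apply: trap_start => //; first by rewrite -e; case: (t).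
  by case: (t).
rewrite last_rcons mem_rcons inE => /orP[/eqP yv|ym].
  by move: vs; rewrite es -yv mem_cat inE eqxx orbT.
have /and3P[_ pc uc] := cs; rewrite es in pc uc vs ds *; rewrite last_cat /=.
apply: trap_walk => //.
- by move: pc; rewrite /= rcons_cat rcons_cons cat_path /= => /and3P[].
- apply: subseq_uniq uc; rewrite -[p :: s1 ++ _]/([:: p] ++ s1 ++ y :: s2).
  by rewrite -[p :: y :: _]/([:: p] ++ _) subseq_cat2l suffix_subseq.
- by apply: contra vs; rewrite mem_cat inE => ->; rewrite !orbT.
- by move=> z zs; apply: ds; rewrite mem_cat inE zs !orbT.
Qed.

End Trap.


(** If all consecutive edges were tied, the whole cycle would lie in one class and be short. *)
Lemma corner_nottied C : is_cyc g C -> l <= size C ->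
  exists p s, same_cyc g C (p :: s) /\ ~ tied p (head p s) p (last p s).
Proof.
move=> cC lC; apply: contrapT => no.
have /and3P[sC _ uC] := cC.
have corner a b w : cstep C b a -> cstep C b w -> tied b a b w.
  move=> ba bc; have /andP[bC _] := cstep_mem ba.
  have [s sc] := cyc_at cC bC; have [/and3P[ss _ us] _ _ es] := sc.
  have [_ H] := cstep_at (ss : 1 < size s) us.
  have hl : tied b (head b s) b (last b s).
    by apply: contrapT => n; apply: no; exists b, s.
  move: ba bc; rewrite -!es !H => /orP[]/eqP-> /orP[]/eqP->; rewrite //; try exact: tied_refl.
  exact: tied_sym.
case: C cC lC sC uC corner {no} => // x [//|y s] cC lC sC uC corner.
suff K e f : cstep [:: x, y & s] e f -> tied x y e f.
  by have := class_cyc_short gS gI l3 gap cC K; rewrite ltnNge lC.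
have main q a b r : (forall u w, dstep [:: a, b & r] u w -> cstep [:: x, y & s] u w) ->
    tied x y a b -> dstep [:: a, b & r] q.1 q.2 -> tied x y q.1 q.2.
  elim: r a b => [|d r IH] a b H ab /=.
    by rewrite !orbF => /andP[/eqP<- /eqP<-].
  case/orP=> [/andP[/eqP<- /eqP<-] //|h1]; apply: (IH b d) => //.
    by move=> u w h2; apply: H; rewrite /= -[_ || dstep (d :: r) u w]/(dstep [:: b, d & r] u w) h2 orbT.
  apply: ttrans ab _; apply/tied_sym/tied_flip/tied_sym.
  apply: corner; last by apply: H; rewrite /= !eqxx orbT.
  by rewrite cstepC; apply: H; rewrite /= !eqxx.
have st u w : dstep (rcons [:: x, y & s] x) u w -> cstep [:: x, y & s] u w.
  by rewrite /cstep /step => ->.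
case/orP=> d.
  by apply: (main (e, f) x y (rcons s x)) => //; apply: tied_refl.
apply: tied_flip.
by apply: (main (f, e) x y (rcons s x)) => //; apply: tied_refl.
Qed.

(** The corner [p] at which the cycle changes class lies on [h]: otherwise the excursion through it
    is an ear, and the short cycle closing this ear ties the two edges at [p]. The shadows of the
    cycle on the two sides of [p] then leave [p] in different classes. *)
Lemma long_transition C : is_cyc g C -> l <= size C ->
  (forall z, z \in C -> deg h z != 0 -> deg h z = 2) ->
  (exists a b, [/\ a != b, a \in C, b \in C, deg h a != 0 & deg h b != 0]) ->
  exists p s, [/\ same_cyc g C (p :: s), transition p, has (fun z => deg h z != 0) s &
    ~ tied p (head p s) p (last p s)].
Proof.
move=> cC lC dC [a [b [ab aC bC da db]]].
have [p [s [sc nt]]] := corner_nottied cC lC; exists p, s.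
have [cps _ mC _] := sc; have /and3P[_ pc uc] := cps.
have ds z : z \in s -> deg h z != 0 -> deg h z = 2.
  by move=> zs; apply: dC; rewrite -mC inE zs orbT.
have in_s z : z \in C -> z != p -> z \in s by rewrite -mC inE => /orP[->|].
have hs : has (fun z => deg h z != 0) s.
  have : (a != p) || (b != p).
    by rewrite -negb_and; apply: contra ab => /andP[/eqP-> /eqP->].
  by case/orP=> np; apply/hasP; [exists a|exists b] => //; apply: in_s.
have pC : p \in C by rewrite -mC inE eqxx.
(* If [p] were off [h], take the nearest vertices [x] and [y] of [h] on its two sides; they differ
   because the cycle meets [h] twice. *)
have dp : deg h p != 0.
  apply/eqP=> dp; have [s1 [y [s2 [es dy ns1]]]] := split_first hs.
  have ap : a != p by apply: contraNneq da => ->; rewrite dp.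
  have bp : b != p by apply: contraNneq db => ->; rewrite dp.
  have hs2 : has (fun z => deg h z != 0) s2.
    have in2 z : z \in C -> z != p -> deg h z != 0 -> z != y -> z \in s2.
      move=> zC zp dz zy; have := in_s z zC zp; rewrite es mem_cat inE (negPf zy) /=.
      by case/orP=> // zs1; case/hasP: ns1; exists z.
    have : (a != y) || (b != y).
      by rewrite -negb_and; apply: contra ab => /andP[/eqP-> /eqP->].
    by case/orP=> ny; apply/hasP; [exists a|exists b] => //; apply: in2.
  have [s3 [x [s4 [es2 dx ns4]]]] := split_last hs2.
  have ess : s = s1 ++ y :: s3 ++ x :: s4 by rewrite es es2.
  have dx2 : deg h x = 2 by apply: ds => //; rewrite ess !(mem_cat, inE) eqxx !orbT.
  have dy2 : deg h y = 2 by apply: ds => //; rewrite ess !(mem_cat, inE) eqxx !orbT.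
  have dI z : z \in s4 ++ p :: s1 -> deg h z = 0.
    rewrite mem_cat inE => /or3P[zs|/eqP->//|zs]; apply/eqP; apply/negPn/negP=> dz.
      by case/hasP: ns4; exists z.
    by case/hasP: ns1; exists z.
  have pc' : is_cyc g (y :: s3 ++ x :: s4 ++ p :: s1).
    have := cps; rewrite ess -[p :: _]/([:: p] ++ _) catA is_cyc_catC.
    by rewrite -cat_cons -catA.
  have /and3P[_ pc2 uc2] := pc'.
  have pQ : path g x (rcons (s4 ++ p :: s1) y).
    by move: pc2; rewrite /= rcons_cat cat_path => /andP[_ /andP[]].
  have uQ : uniq (x :: rcons (s4 ++ p :: s1) y).
    rewrite -rcons_cons rcons_uniq; move: uc2; rewrite cons_uniq => /andP[yn].
    rewrite cat_uniq => /and3P[_ _ ->]; rewrite andbT.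
    by apply: contra yn; rewrite mem_cat => ->; rewrite orbT.
  have [|J [cS sS _]] := ear_short gS gI hmax dx2 dy2 dI uQ pQ.
    by left; case: (s4).
  apply: nt; apply: tied_cyc cS sS _ _; rewrite cstep_split; apply/orP; left.
    rewrite rcons_cat -cat_cons.
    have -> : rcons (p :: s1) y = [:: p, head p s & behead (rcons s1 y)].
      by rewrite ess; case: (s1).
    exact: step_mid.
  rewrite rcons_cat -cat_cons lastI cat_rcons stepC.
  have -> : last x s4 = last p s by rewrite ess last_cat /= last_cat.
  exact: step_mid.
have dp2 := dC p pC dp.
have nbr s' : is_cyc g (p :: s') -> s' =i s -> exists n, h p n /\ tied p (head p s') p n.
  move=> cs' ss'.
  have hs' : has (fun z => deg h z != 0) s' by rewrite (eq_has_r ss').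
  have ds' z : z \in s' -> deg h z != 0 -> deg h z = 2 by rewrite ss'; apply: ds.
  have [y [_ [_ [t [_ _ pt [_ _ th]]]]]] := first_link dp2 cs' hs' ds'.
  by exists (head y t); split=> //; case: (t) pt => /= [|? ?] /andP[].
have [n1 [hn1 tn1]] := nbr s cps (fun _ => erefl).
have [n2 [hn2 tn2]] : exists n, h p n /\ tied p (last p s) p n.
  have [|z|n] := nbr (rev s); [by apply: is_cyc_rev_at|by rewrite mem_rev|].
  by case: (lastP s) => [|s' q]; rewrite ?rev_rcons ?last_rcons /=; exists n.
have n12 : n1 != n2.
  apply/eqP=> e; apply: nt; apply: ttrans tn1 _; rewrite e; exact: tied_sym.
split=> //; split=> // u w pu pw uw tuw; apply: nt.
apply: (ttrans tn1); apply: (fun H => ttrans H (tied_sym tn2)).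
case: (deg2P dp2 hn1 hn2 n12 pu) (deg2P dp2 hn1 hn2 n12 pw) uw tuw => -> [] -> //; rewrite ?eqxx //.
by move=> _; apply: tied_sym.
Qed.

(** The segment towards [v] leaves [p] in the class of one of the two cycle edges at [p]. If the
    cycle missed [v], [trap_side], applied to the cycle or to its reverse, would put the other edge
    into that class too. *)
Lemma transition_trap C p s v m : is_cyc g C -> same_cyc g C (p :: s) ->
  (forall z, z \in C -> deg h z != 0 -> deg h z = 2) ->
  has (fun z => deg h z != 0) s -> ~ tied p (head p s) p (last p s) ->
  transition p -> transition v -> path h p (rcons m v) -> uniq (p :: rcons m v) ->
  (forall z, z \in m -> deg h z = 2) -> v \in C.
Proof.
move=> cC sc dC hs nt tp tv pm um dm; apply: contrapT => /negP vC.
have [cps _ mC _] := sc.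
have ds z : z \in s -> deg h z != 0 -> deg h z = 2.
  by move=> zs; apply: dC; rewrite -mC inE zs orbT.
have vs : v \notin s by apply: contra vC; rewrite -mC inE => ->; rewrite orbT.
have crev := is_cyc_rev_at gS cps.
have hsr : has (fun z => deg h z != 0) (rev s) by rewrite has_rev.
have dsr z : z \in rev s -> deg h z != 0 -> deg h z = 2 by rewrite mem_rev; apply: ds.
have vsr : v \notin rev s by rewrite mem_rev.
have hr : head p (rev s) = last p s.
  by case: (lastP s) => [|s' q]; rewrite ?rev_rcons ?last_rcons.
have lr : last p (rev s) = head p s.
  by case: (s) => [|q s'] //; rewrite rev_cons last_rcons.
have dp := proj1 tp.
have [y [_ [_ [t [_ _ pt [_ _ th]]]]]] := first_link dp cps hs ds.
have [y' [_ [_ [t' [_ _ pt' [_ _ th']]]]]] := first_link dp crev hsr dsr.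
have hn : h p (head y t) by case: (t) pt => /= [|? ?] /andP[].
have hn' : h p (head y' t') by case: (t') pt' => /= [|? ?] /andP[].
rewrite hr in th'.
have nn : head y t != head y' t'.
  by apply/eqP=> e; apply: nt; apply: ttrans th _; rewrite e; exact: tied_sym.
have hn1 : h p (head v m) by case: (m) pm => /= [|b m'] /andP[].
case: (deg2P dp hn hn' nn hn1) => e; apply: nt.
  apply: (ttrans th); rewrite -e; apply: tied_sym.
  by apply: (trap_side tp tv pm um dm cps hs ds vs); rewrite e.
apply: tied_sym; apply: (ttrans th'); rewrite -e; apply: tied_sym; rewrite -lr.
by apply: (trap_side tp tv pm um dm crev hsr dsr vsr); rewrite hr e.
Qed.

(* If they met, any edge of [z :: s] would lie with the first edge of
   [z' :: s'] on a short cycle through [h]. *)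
Lemma tangent_disjoint z s z' s' : is_cyc g (z :: s) -> is_cyc g (z' :: s') ->
  l <= size (z :: s) -> deg h z = 2 -> deg h z' = 2 -> z != z' ->
  (forall w, w \in s -> deg h w = 0) -> (forall w, w \in s' -> deg h w = 0) ->
  ~~ has [in z :: s] (z' :: s').
Proof.
move=> cs cs' ls dz dz' zz' ds ds'; apply/negP=> hs.
have z'C : z' \notin z :: s.
  by rewrite inE negb_or eq_sym zz' /=; apply/negP=> /ds; rewrite dz'.
rewrite /= (negPf z'C) /= in hs.
have [r1 [h0 [r2 [es' h0C nr1]]]] := split_first hs.
have h0s : h0 \in s.
  move: h0C; rewrite inE => /orP[/eqP e|//].
  by have := ds' z; rewrite es' mem_cat e inE eqxx orbT dz => /(_ isT).
have dr1 w : w \in r1 -> deg h w = 0 by move=> wr; apply: ds'; rewrite es' mem_cat wr.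
have /and3P[_ pc' uc'] := cs'; rewrite es' in pc' uc'.
have p1 : path g z' (rcons r1 h0).
  by move: pc'; rewrite /= rcons_cat rcons_cons -cat_rcons cat_path => /andP[].
have u1 : uniq (z' :: rcons r1 h0).
  have : uniq ((z' :: rcons r1 h0) ++ r2) by rewrite /= cat_rcons.
  by rewrite cat_uniq => /andP[].
case/splitPr: h0s cs ls ds z'C nr1 {hs h0C} => s1 s2 cs ls ds z'C nr1.
have ear s3 : path g h0 (rcons s3 z) -> uniq (h0 :: rcons s3 z) ->
    {subset h0 :: rcons s3 z <= z :: s1 ++ h0 :: s2} ->
    (forall w, w \in s3 -> deg h w = 0) ->
    exists S, [/\ is_cyc g S, size S < l, cstep S z' (head h0 r1) &
      forall u w, step (h0 :: rcons s3 z) u w -> cstep S u w].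
  move=> p3 u3 sub3 d3.
  have [||||J [cS sS _]] := ear_short gS gI hmax (x := z') (y := z) (s := r1 ++ h0 :: s3) dz' dz.
  - move=> w; rewrite mem_cat inE => /or3P[/dr1//|/eqP->|/d3//].
    by apply: ds; rewrite mem_cat inE eqxx orbT.
  - rewrite rcons_cat rcons_cons -cat_cons cat_uniq u3 andbT.
    have /andP[_ ->] : (h0 \notin z' :: r1) && uniq (z' :: r1) by rewrite -rcons_uniq.
    rewrite andTb.
    apply/hasPn=> w ws; have wC := sub3 w ws; rewrite inE negb_or; apply/andP; split.
      by apply: contra z'C => /eqP<-.
    by apply: contra nr1 => wr; apply/hasP; exists w.
  - rewrite rcons_cat rcons_cons -cat_rcons cat_path p1 last_rcons //.
  - by left; case: (r1).
  exists (z' :: (r1 ++ h0 :: s3) ++ z :: J); split=> //.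
    rewrite cstep_split; apply/orP; left.
    by case: (r1) => [|b r]; rewrite /= step_cons2 !eqxx.
  move=> u w st; rewrite cstep_split; apply/orP; left.
  by rewrite rcons_cat rcons_cons -cat_cons step_cat st orbT.
have /and3P[_ pc uc] := cs.
have [||||S2 [cS2 sS2 S2e S2s]] := ear s2.
- by move: pc; rewrite /= rcons_cat cat_path => /andP[_ /andP[]].
- rewrite -rcons_cons rcons_uniq; move: uc => /= /andP[+ +].
  by rewrite mem_cat negb_or cat_uniq => /andP[_ ->] /and3P[].
- move=> w; rewrite !(inE, mem_rcons, mem_cat).
  by case/or3P=> ->; rewrite ?orbT.
- by move=> w ws; apply: ds; rewrite mem_cat inE ws !orbT.
have [||||S1 [cS1 sS1 S1e S1s]] := ear (rev s1).
- by rewrite -path_revS //; move: pc; rewrite /= rcons_cat rcons_cons -cat_rcons cat_path => /andP[].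
- rewrite -rev_cons -rev_rcons rev_uniq rcons_cons.
  have : uniq ((z :: rcons s1 h0) ++ s2) by rewrite /= cat_rcons.
  by rewrite cat_uniq => /andP[].
- move=> w; rewrite !(inE, mem_rcons, mem_cat) mem_rev.
  by case/or3P=> ->; rewrite ?orbT.
- by move=> w; rewrite mem_rev => ws; apply: ds; rewrite mem_cat ws.
have K u w : cstep (z :: s1 ++ h0 :: s2) u w -> tied z' (head h0 r1) u w.
  rewrite cstep_split => /orP[st|st].
    apply: tied_cyc cS1 sS1 S1e _; apply: S1s.
    by rewrite -step_rev rev_cons rev_rcons revK.
  by apply: tied_cyc cS2 sS2 S2e _; apply: S2s.
by have := class_cyc_short gS gI l3 gap cs K; rewrite ltnNge ls.
Qed.

End Separation.

(** * Hitting sets for long cycles *)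

Lemma uniq_flatten_map (I T : eqType) (s : seq I) (f : I -> seq T) : uniq s ->
  {in s, forall i, uniq (f i)} ->
  {in s &, forall i j, i != j -> ~~ has [in f i] (f j)} -> uniq (flatten (map f s)).
Proof.
elim: s => //= i s IH /andP[ni us] uf df; rewrite cat_uniq uf ?mem_head //=.
rewrite IH //; first last.
- by move=> j k js ks; apply: df; rewrite inE ?js ?ks orbT.
- by move=> j js; apply: uf; rewrite inE js orbT.
rewrite andbT; apply/hasPn=> x /flatten_mapP[j js xj]; apply/negP=> xi.
have ij : i != j by apply: contraNneq ni => ->.
have jis : j \in i :: s by rewrite inE js orbT.
by have /hasP := df i j (mem_head _ _) jis ij; case; exists x.
Qed.

Section Packing.
Variables (V : finType) (g : rel V) (l : nat).

Definition packing n := exists cs, [/\ size cs = n, all (is_cyc g) cs,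
  all (fun c => l <= size c) cs & uniq (flatten cs)].

Lemma packing_family (I : eqType) (s : seq I) (f : I -> seq V) n : uniq s -> n <= size s ->
  {in s, forall i, is_cyc g (f i) /\ l <= size (f i)} ->
  {in s &, forall i j, i != j -> ~~ has [in f i] (f j)} -> packing n.
Proof.
move=> us ns lf df; exists (map f (take n s)).
have sub : {subset take n s <= s} by move=> i; apply: mem_take.
split.
- by rewrite size_map size_takel.
- by apply/allP=> c /mapP[i /sub/lf[? _] ->].
- by apply/allP=> c /mapP[i /sub/lf[_ ?] ->].
- apply: uniq_flatten_map; first exact: take_uniq.
    by move=> i /sub/lf[/and3P[]].
  by move=> i j /sub si /sub sj; apply: df.
Qed.

End Packing.

Section HittingSet.
Variables (V : finType) (g : rel V) (l : nat).
Hypotheses (gS : symmetric g) (gI : irreflexive g) (l3 : 2 < l).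
Hypothesis gap : forall c, is_cyc g c -> size c < l \/ l.*2 < size c.
Variable h : rel V.
Hypothesis hmax : maximal_good g l h.
Variables (t N n : nat).
Hypotheses (t0 : 0 < t) (tN : 2 * (N * t.*2.-1) + 6 < 3 * 2 ^ t.-1) (nN : n <= N).
Hypothesis nopack : ~ packing g l n.+1.
Implicit Types (c s : seq V) (x y z : V) (K : {set V}).

Let hS := maxS hmax.
Let hI := maxI gI hmax.

Let U := [set x | deg h x == 3].
Let D := [set x | deg h x == 2].

Let degUD x y : h x y -> x \in U :|: D.
Proof.
move=> hxy; rewrite !inE; have := max_deg hmax x; rewrite !inE => /or3P[/eqP dx|->|->]; rewrite ?orbT //.
by have := deg0P y dx; rewrite hxy.
Qed.

Let dgUD x : dg h (U :|: D) x = deg h x.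
Proof.
by apply: eq_card => y; rewrite !inE andb_idl // hS => /degUD; rewrite !inE.
Qed.

Let dg3 x : dg h setT x <= 3.
Proof.
rewrite (_ : dg h setT x = deg h x); last by apply: eq_card => y; rewrite !inE.
by have := max_deg hmax x; rewrite !inE => /or3P[]/eqP->.
Qed.

Let disUD : [disjoint U & D].
Proof.
rewrite -setI_eq0; apply/eqP/setP=> x; rewrite !inE.
by case: eqP => // ->.
Qed.

Let h_long c : is_cyc h c -> is_cyc g c /\ l <= size c.
Proof. by move=> cc; split; [exact: sub_is_cyc (max_sub hmax) cc|exact (max_long hmax cc)]. Qed.

(** With degrees 2 and 3 only, [#|U|] is twice the excess of edges over vertices, and a large excess
    yields [n + 1] disjoint cycles of [h], all of them long. *)
Lemma branch_bound : #|U| <= (n * t.*2.-1).*2.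
Proof.
have eS : (nedges h (U :|: D)).*2 = #|U :|: D|.*2 + #|U|.
  rewrite -crossAA // crossE (eq_bigr (deg h)) => [|x _]; last exact: dgUD.
  rewrite (big_setID U) /= setUK setDUl setDv set0U (setDidPl _); last first.
    by rewrite disjoint_sym.
  rewrite (eq_bigr (fun=> 3)) => [|x]; last by rewrite inE => /eqP.
  rewrite [X in _ + X](eq_bigr (fun=> 2)) => [|x]; last by rewrite inE => /eqP.
  rewrite !sum_nat_const cardsU; move: disUD; rewrite -setI_eq0 => /eqP->.
  by rewrite cards0; clear; lia.
rewrite leqNgt; apply/negP=> big; apply: nopack.
have [|cs [s1 s2 s3 _]] := disjoint_cycles hS hI (A := U :|: D) dg3 t0 tN nN.
  by move: eS big; move: (n * _) #|U| #|_ :|: _| (nedges _ _); clear; lia.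
exists cs; split=> //.
  by apply/allP=> c /(allP s2)/h_long[].
by apply/allP=> c /(allP s2)/h_long[].
Qed.

Let hD x y := [&& x \in D, y \in D & h x y].

Let hD_sym : connect_sym hD.
Proof. by apply: sym_connect_sym => x y; rewrite /hD hS andbCA. Qed.

Let P := equivalence_partition (connect hD) D.

Let eqD : {in D & &, equivalence_rel (connect hD)}.
Proof.
move=> x y z _ _ _; split=> [|xy]; first exact: connect0.
by apply/idP/idP; apply: connect_trans; rewrite // hD_sym.
Qed.

Let partP : partition P D.
Proof. exact: equivalence_partitionP. Qed.

Let PE K x : K \in P -> x \in K -> x \in D /\ forall y, (y \in K) = (y \in D) && connect hD x y.
Proof.
case/imsetP=> z zD ->; rewrite inE => /andP[xD zx]; split=> // y.
rewrite inE; case: (boolP (y \in D)) => //= yD.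
by apply/idP/idP; apply: connect_trans; rewrite // hD_sym.
Qed.

Let cross_component K : K \in P -> cross h K U + (nedges h K).*2 = #|K|.*2.
Proof.
move=> KP; rewrite -crossAA // !crossE -big_split /=.
rewrite (eq_bigr (fun=> 2)) => [|x xK]; first by rewrite sum_nat_const muln2.
have [xD xE] := PE KP xK.
have <- : dg h D x = dg h K x.
  apply: eq_card => y; rewrite !inE xE [in RHS]inE; case: eqP => //= dy.
  rewrite andb_idl // => hxy; apply: connect1.
  by rewrite /hD xD hxy inE dy eqxx.
by rewrite -dgU // dgUD; move: xD; rewrite inE => /eqP.
Qed.

(** A component with as many edges as vertices contains a cycle of [h]; these cycles are disjoint,
    so there are at most [n]. Any other component sends at least 2 edges to [U], which receives at
    most [3 * #|U|]. *)
Lemma component_bound : #|P|.*2 <= n.*2 + 3 * #|U|.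
Proof.
pose Pc := [set K in P | #|K| <= nedges h K].
have cPc : #|Pc| <= n.
  rewrite leqNgt; apply/negP=> big; apply: nopack.
  have /choice[f fP] K : exists c, K \in Pc -> is_cyc h c /\ {subset c <= K}.
    have [KPc|nK] := boolP (K \in Pc); last by exists [::].
    move: (KPc); rewrite inE => /andP[KP KE].
    have [c cP] := set_cyc hS hI (partition_neq0 partP KP) KE.
    by exists c.
  apply: (packing_family (s := enum Pc) (f := f)).
  - exact: enum_uniq.
  - by rewrite -cardE.
  - by move=> K; rewrite mem_enum => /fP[/h_long].
  - move=> K K'; rewrite !mem_enum => KP KP' KK'; apply/hasP=> -[x xK' xK].
    have [_ /(_ x xK) xK1] := fP K KP; have [_ /(_ x xK') xK2] := fP K' KP'.
    move: KP KP'; rewrite !inE => /andP[KP _] /andP[KP' _].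
    have /trivIsetP/(_ K K' KP KP' KK') := partition_trivIset partP.
    by rewrite disjoint_subset => /subsetP/(_ x xK1); rewrite inE xK2.
have cPn : #|P :\: Pc|.*2 <= 3 * #|U|.
  apply: (@leq_trans (\sum_(K in P) cross h K U)).
    rewrite -muln2 -sum_nat_const [X in _ <= X](big_setID (P :\: Pc)) /=.
    rewrite (setIidPr _) ?subsetDl //; apply: leq_trans (leq_addr _ _).
    apply: leq_sum => K; rewrite !inE => /andP[nK KP]; move: nK; rewrite KP /= -ltnNge => lt.
    by have := cross_component KP; move: lt; clear; lia.
  rewrite (eq_bigr (fun K : {set V} => \sum_(x in K) dg h U x)) => [|K _]; last exact: crossE.
  rewrite -(set_partition_big _ partP) -crossE crossC // crossE mulnC -sum_nat_const.
  by apply: leq_sum => x _; apply: leq_trans (dg3 x); apply: dg_le; apply: subsetT.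
have : #|P| <= #|Pc| + #|P :\: Pc|.
  rewrite -(cardsID Pc P) leq_add2r; apply: subset_leq_card; exact: subsetIr.
by move: cPc cPn; clear; lia.
Qed.

(** A long cycle meeting [h] in one vertex has no excursion between two vertices of [h], so
    maximality cannot be used on it; it is hit directly. *)
Let Z := [set z in D | `[< exists s, [/\ is_cyc g (z :: s), l <= size (z :: s) &
  forall w, w \in s -> deg h w = 0] >]].

Lemma tangent_bound : #|Z| <= n.
Proof.
rewrite leqNgt; apply/negP=> big; apply: nopack.
have /choice[f fP] z : exists s, z \in Z -> [/\ is_cyc g (z :: s), l <= size (z :: s) &
  forall w, w \in s -> deg h w = 0].
  have [|nz] := boolP (z \in Z); last by exists [::].
  by rewrite inE => /andP[_ /asboolP[s sP]]; exists s.
apply: (packing_family (s := enum Z) (f := fun z => z :: f z)).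
- exact: enum_uniq.
- by rewrite -cardE.
- by move=> z; rewrite mem_enum => /fP[].
- move=> z z'; rewrite !mem_enum => zZ z'Z zz'.
  have [c1 l1 d1] := fP z zZ; have [c2 l2 d2] := fP z' z'Z.
  have dZ w : w \in Z -> deg h w = 2 by rewrite !inE => /andP[/eqP].
  by apply: (tangent_disjoint gS gI l3 gap hmax c1 c2 l1); rewrite ?dZ.
Qed.

(** One transition per component is enough, by [transition_trap]. *)
Let trans_pick K := [pick x in K | `[< transition g l h x >]].
Let R := [set x | Some x \in [set trans_pick K | K in P]].

Let cardR : #|R| <= #|P|.
Proof.
rewrite -(card_imset R (f := @Some V)); last by move=> ? ? [].
apply: leq_trans (leq_imset_card trans_pick P).
by apply: subset_leq_card; apply/subsetP=> _ /imsetP[x + ->]; rewrite inE.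
Qed.

(** With [M = n (2 t - 1)], the sets [U], [Z] and [R] contribute at most [2 M], [n] and
    [n + 3 M]. *)
Lemma hitting_set : exists X : {set V}, #|X| <= 5 * (n * t.*2.-1) + n.*2 /\
  forall c, is_cyc g c -> {in c, forall x, x \notin X} -> size c < l.
Proof.
exists (U :|: Z :|: R); split.
  have := cardsUI (U :|: Z) R; have := cardsUI U Z.
  have := tangent_bound; have := branch_bound; have := component_bound; have := cardR.
  by move: #|P| #|R| #|U| #|Z| (n * t.*2.-1) #|U :|: Z| #|_ :|: R|; clear; lia.
move=> C cC CX; rewrite ltnNge; apply/negP=> lC.
have {}CX x : x \in C -> [/\ x \notin U, x \notin Z & x \notin R].
  by move/CX; rewrite !in_setU !negb_or -andbA => /and3P[].
have dC z : z \in C -> deg h z != 0 -> deg h z = 2.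
  move=> zC; have [zU _ _] := CX z zC; have := max_deg hmax z.
  by move: zU; rewrite !inE => /negPf-> /or3P[->|/eqP|].
have [a aC da] : exists2 a, a \in C & deg h a != 0.
  apply: contrapT => no; apply: (disjoint_long_cycle gS hmax cC lC) => z zC.
  by apply/eqP; apply: contraT => dz; case: no; exists z.
have two : exists a b, [/\ a != b, a \in C, b \in C, deg h a != 0 & deg h b != 0].
  apply: contrapT => no; have [_ + _] := CX a aC; move/negP; apply.
  rewrite inE; apply/andP; split; first by rewrite inE dC.
  have [s [cs szs ms _]] := cyc_at cC aC; apply/asboolP; exists s; split=> //.
    by rewrite szs.
  move=> w ws; apply/eqP; apply: contraT => dw; case: no; exists a, w; split=> //.
    by apply: contraTneq ws => <-; case/and3P: cs => _ _ /andP[].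
  by rewrite -ms inE ws orbT.
have [p [s [sc tp hs nt]]] := long_transition gS gI l3 gap hmax cC lC dC two.
have pC : p \in C by have [_ _ <- _] := sc; rewrite inE eqxx.
have pD : p \in D by rewrite inE (proj1 tp).
have coverP : p \in cover P by rewrite (cover_partition partP).
have KP : pblock P p \in P by rewrite pblock_mem.
have pK : p \in pblock P p by rewrite mem_pblock.
have [v [vK tv vR]] : exists v, [/\ v \in pblock P p, transition g l h v & v \in R].
  case E : (trans_pick (pblock P p)) => [v|].
    have vR : v \in R by rewrite inE -E; apply: imset_f.
    exists v; move: E; rewrite /trans_pick; case: pickP => // w /andP[wK /asboolP tw] [e].
    by rewrite e in wK tw.
  move: E; rewrite /trans_pick; case: pickP => // /(_ p); rewrite pK /=.
  by move/negP; case; apply/asboolP.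
(* The component of [p] joins [p] to the picked [v] by a path of [h] through vertices of degree 2,
   so [C] would have to contain [v]. *)
have [_ pE] := PE KP pK; move: (vK); rewrite pE => /andP[_ /connectP[q0 pq0 eq0]].
have pv : p != v by apply: contraTneq vR => <-; have [] := CX p pC.
case/shortenP: pq0 eq0 => q pq uq _ eq.
case: (lastP q) pq uq eq => [|m w] pq uq eq; first by rewrite eq eqxx in pv.
rewrite last_rcons in eq; rewrite -eq in pq uq.
have vC : v \in C.
  apply: (transition_trap gS gI gap hmax cC sc dC hs nt tp tv (m := m)) => //.
    by apply: sub_path pq => x y /and3P[].
  have pathD r : forall b, path hD b r -> all [in D] r.
    by elim: r => //= b r IH b' /andP[/and3P[_ -> _] /IH].
  move: (pathD _ _ pq).
  by rewrite all_rcons => /andP[_ /allP am] z /am; rewrite inE => /eqP.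
by have [_ _ /negP] := CX v vC.
Qed.

End HittingSet.

Lemma flatten_disjoint (T : eqType) (cs : seq (seq T)) i j : uniq (flatten cs) ->
  i < size cs -> j < size cs -> i != j -> ~~ has [in nth [::] cs i] (nth [::] cs j).
Proof.
elim: cs i j => //= c cs IH; rewrite cat_uniq => -[|i] [|j] //= /and3P[_ d u].
- move=> _ js _; apply: contra d => /hasP[x xj xc]; apply/hasP; exists x => //.
  by apply/flattenP; exists (nth [::] cs j); rewrite ?mem_nth.
- move=> si _ _; apply: contra d => /hasP[x xc xi]; apply/hasP; exists x => //.
  by apply/flattenP; exists (nth [::] cs i); rewrite ?mem_nth.
- by move=> si sj ij; apply: IH.
Qed.

Lemma packing_or_hitting_set (V : finType) (g : rel V) l t N n :
  symmetric g -> irreflexive g -> 2 < l ->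
  (forall c, is_cyc g c -> size c < l \/ l.*2 < size c) ->
  0 < t -> 2 * (N * t.*2.-1) + 6 < 3 * 2 ^ t.-1 -> n <= N ->
  packing g l n.+1 \/ exists X : {set V}, #|X| <= 5 * (n * t.*2.-1) + n.*2 /\
    forall c, is_cyc g c -> {in c, forall x, x \notin X} -> size c < l.
Proof.
move=> gS gI l3 gap t0 tN nN; have [h hmax] := exists_maximal_good g l.
have [|np] := pselect (packing g l n.+1); first by left.
by right; apply: (hitting_set gS gI l3 gap hmax t0 tN nN np).
Qed.

(** * Cycles of prescribed minimum lengths *)

Section Families.
Variables (k : nat) (l : 'I_k -> nat) (t N : nat).
Hypotheses (l3 : forall i, 2 < l i) (t0 : 0 < t) (kN : k <= N.+1).
Hypothesis tN : 2 * (N * t.*2.-1) + 6 < 3 * 2 ^ t.-1.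

Definition cycle_family (V : finType) (g : rel V) (J : {set 'I_k}) (f : 'I_k -> seq V) :=
  {in J, forall i, is_cyc g (f i) /\ l i <= size (f i)} /\
  {in J &, forall i j, i != j -> ~~ has [in f i] (f j)}.

(** Twice the sum of the lengths pays for the deleted cycles and, in the end, also for [m], which
    the treewidth bound adds to [#|X|]. *)
Lemma cycle_family_or_hitting_set (V : finType) (g : rel V) (J : {set 'I_k}) :
  symmetric g -> irreflexive g ->
  (exists f, cycle_family g J f) \/
  exists (X : {set V}) m, [/\ 2 < m,
    forall c, is_cyc g c -> {in c, forall x, x \notin X} -> size c < m &
    #|X| + m <= (\sum_(i in J) l i).*2 + 5 * (#|J|.-1 * t.*2.-1) + #|J|.*2].
Proof.
have [n] := ubnP #|J|; elim: n g J => // n IH g J Jn gS gI.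
have [->|[i0 i0J]] := set_0Vmem J.
  by left; exists (fun _ => [::]); split=> i; rewrite inE.
have [i iJ imax] := arg_maxnP l i0J.
have {}iJ : i \in J by exact: iJ.
have cardJ : #|J| = #|J :\ i|.+1 by rewrite (cardsD1 i) iJ.
have [[C [cC lC C2l]]|no] :=
  pselect (exists C, [/\ is_cyc g C, l i <= size C & size C <= (l i).*2]).
  (* The vertices of [C] are isolated rather than removed, so that [V] stays the same in the
     induction. *)
  pose g' x y := [&& g x y, x \notin C & y \notin C].
  have g'S : symmetric g' by move=> x y; rewrite /g' gS; congr (_ && _); apply: andbC.
  have g'I : irreflexive g' by move=> x; rewrite /g' gI.
  have g'g : subrel g' g by move=> x y /and3P[].
  have off c : is_cyc g' c -> ~~ has [in C] c.
    move=> cc; apply/hasP=> -[x xc xC]; have [s [/and3P[_ ps _] _ _ _]] := cyc_at cc xc.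
    by move: ps; case: s => [|y s] /= /andP[/and3P[_ /negP]].
  have [|||[f [f1 f2]]|[X [m [m3 Xm Xs]]]] := IH g' (J :\ i) => //.
  - by move: Jn; rewrite cardJ; clear; lia.
  - left; exists (fun j => if j == i then C else f j); split.
      move=> j jJ; case: eqVneq => [->|ji] //.
      have [|cf lf] := f1 j; first by rewrite !inE ji.
      by split=> //; apply: sub_is_cyc g'g cf.
    move=> j j' jJ j'J; case: (eqVneq j i) => [ej|ji]; case: (eqVneq j' i) => [ej'|j'i].
    + by rewrite ej ej' eqxx.
    + by move=> _; apply: off; have [|//] := f1 j'; rewrite !inE j'i.
    + by move=> _; rewrite has_sym; apply: off; have [|//] := f1 j; rewrite !inE ji.
    + by apply: f2; rewrite !inE ?ji ?j'i.
  - right; exists (X :|: [set x in C]), m; split=> //.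
      move=> c cc cX; apply: Xm => [|x /cX]; last by rewrite inE negb_or => /andP[].
      have /and3P[sc pc uc] := cc; rewrite /is_cyc sc uc andbT /=.
      have cC' x : x \in c -> x \notin C by move/cX; rewrite !inE negb_or => /andP[].
      apply: (sub_in_cycle (P := [in c])) pc; last by apply/allP.
      by move=> x y xc yc; rewrite /g' => ->; rewrite !cC'.
    have cardC : #|[set x in C]| <= size C by rewrite cardsE card_size.
    have := cardsUI X [set x in C].
    have -> : (\sum_(j in J) l j) = l i + \sum_(j in J :\ i) l j by rewrite (big_setD1 i).
    have mon : #|J :\ i|.-1 * t.*2.-1 <= #|J|.-1 * t.*2.-1.
      by rewrite leq_mul2r cardJ leq_pred orbT.
    move: Xs mon cardC C2l; rewrite cardJ -pred_Sn.
    have aux (x y z c d e s p q r a : nat) : x + y <= s.*2 + 5 * p + a.*2 -> p <= q ->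
        c <= d -> d <= r.*2 -> e + z = x + c -> e + y <= (r + s).*2 + 5 * q + a.+1.*2.
      by clear; lia.
    exact: aux.
have gap c : is_cyc g c -> size c < l i \/ (l i).*2 < size c.
  move=> cc; case: ltnP => lc; [by left|right]; rewrite ltnNge; apply/negP=> le.
  by apply: no; exists c.
have JN : #|J|.-1 <= N.
  rewrite cardJ -ltnS -cardJ; apply: leq_trans kN.
  by have := max_card [in J]; rewrite card_ord.
have [[cs [s1 s2 s3 s4]]|[X [Xs Xm]]] := packing_or_hitting_set gS gI (l3 i) gap t0 tN JN.
  (* Every cycle of the packing is at least as long as the largest prescribed length, so any
     assignment works. *)
  left; exists (fun j => nth [::] cs (index j (enum J))).
  have idx j : j \in J -> index j (enum J) < size cs.
    by move=> jJ; rewrite s1 cardJ /= -cardJ cardE index_mem mem_enum.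
  split=> [j jJ|j j' jJ j'J jj'].
    have inc : nth [::] cs (index j (enum J)) \in cs by rewrite mem_nth ?idx.
    split; first exact: (allP s2).
    by apply: leq_trans (allP s3 _ inc); apply: imax.
  apply: flatten_disjoint; rewrite ?idx //.
  apply: contra jj' => /eqP e; apply/eqP.
  by rewrite -(nth_index i (_ : j \in enum J)) ?mem_enum // e nth_index ?mem_enum.
right; exists X, (l i); split=> //.
have : l i <= \sum_(j in J) l j by rewrite (bigD1 i) //= leq_addr.
move: Xs; rewrite cardJ -pred_Sn => Xs le.
have aux (x p a m s : nat) : x <= 5 * p + a.*2 -> m <= s -> x + m <= s.*2 + 5 * p + a.+1.*2.
  by clear; lia.
exact: aux.
Qed.

End Families.

(** * Treewidth of graphs without long cycles *)

Section ParentTree.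
Variables (T : finType) (root : T) (par : T -> T) (rank : T -> nat).
Hypothesis par_root : par root = root.
Hypothesis rank_par : forall a, a != root -> rank (par a) < rank a.

Definition par_adj : rel T := fun a b => (a != b) && ((par a == b) || (par b == a)).

Lemma par_adj_sym : symmetric par_adj.
Proof. by move=> a b; rewrite /par_adj eq_sym orbC. Qed.

Lemma par_adj_irrefl : irreflexive par_adj.
Proof. by move=> a; rewrite /par_adj eqxx. Qed.

Definition par_graph := SGraph par_adj_sym par_adj_irrefl.

(** From every vertex of [S], the climb through parents stays in [S] until it reaches [top]. *)
Lemma par_connected (S : {set T}) top : top \in S ->
  (forall a, a \in S -> a != top -> a != root /\ par a \in S) -> @connected_in par_graph S.
Proof.
move=> topS H.
have rS : connect_sym [rel u v in S | par_adj u v].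
  by apply: sym_connect_sym => a b; rewrite /= par_adj_sym [(a \in S) && _]andbC.
have to_top a : a \in S -> connect [rel u v in S | par_adj u v] a top.
  have [n] := ubnP (rank a); elim: n a => // n IH a an aS.
  have [->|at_] := eqVneq a top; first exact: connect0.
  have [ar pS] := H a aS at_; have lt := rank_par ar.
  apply: (@connect_trans _ _ (par a)); last by apply: IH => //; apply: leq_trans lt _.
  apply: connect1; rewrite /= aS pS /par_adj eqxx /= andbT.
  by apply: contraTneq lt => <-; rewrite ltnn.
move=> a b aS bS; apply: connect_trans (to_top a aS) _.
by have := to_top b bS; rewrite rS.
Qed.

(** On a cycle, both neighbours of a vertex of largest rank would be its parent. *)
Lemma par_tree : is_tree par_graph.
Proof.
split.
- by apply/card_gt0P; exists root.
- by apply: (par_connected (top := root)) => // a _ ar; split; rewrite ?inE.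
- move=> c sc /andP[pc uc].
  have [t0 t0c] : exists t0, t0 \in c by case: (c) sc => // a s _; exists a; rewrite inE eqxx.
  have [t tc tmax] := arg_maxnP rank (t0c : [in c] t0).
  have {}tc : t \in c by exact: tc.
  have cc : is_cyc par_adj c by rewrite /is_cyc sc pc uc.
  have [p [q [pq H]]] := cyc_nbrs sc uc tc.
  have up w : cstep c t w -> par t = w.
    move=> tw; have /andP[ntw] := is_cyc_step par_adj_sym cc tw.
    case/orP=> /eqP // e; have /andP[_ wc] := cstep_mem tw.
    have [wr|wr] := eqVneq w root.
      by rewrite -e wr par_root eqxx in ntw.
    have := rank_par wr; rewrite e ltnNge => /negP[]; exact: tmax.
  move: pq; rewrite -(up p) ?H ?eqxx // -(up q) ?H ?eqxx ?orbT //.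
Qed.
End ParentTree.

(** * Depth-first forests *)

Section DepthFirstForest.
Variables (V : finType) (g : rel V).
Hypotheses (gS : symmetric g) (gI : irreflexive g).

(* [p v] lists the vertices on the path from [v] to the root of its tree. *)
Definition forest (p : V -> seq V) :=
  forall v, p v = [:: v] \/ exists2 u, g v u & p v = v :: p u.

Section Forest.
Variable p : V -> seq V.
Hypothesis fp : forest p.

Lemma forest_head v : exists s, p v = v :: s.
Proof. by case: (fp v) => [->|[u _ ->]]; [exists [::]|exists (p u)]. Qed.

Lemma forest_suffix v x : x \in p v -> exists s, p v = s ++ p x.
Proof.
have [n] := ubnP (size (p v)); elim: n v => // n IH v.
case: (fp v) => [e|[u _ e]]; rewrite e => sn.
  by rewrite inE => /eqP->; exists [::]; rewrite e.
rewrite inE => /orP[/eqP->|xu]; first by exists [::]; rewrite e.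
by have [|s ->] := IH u _ xu; [|exists (v :: s)].
Qed.

Lemma forest_parent_fresh v u : p v = v :: p u -> v \notin p u.
Proof.
move=> e; apply/negP=> /forest_suffix[s] /(congr1 size).
by rewrite e size_cat /=; clear; lia.
Qed.

Lemma forest_uniq v : uniq (p v).
Proof.
have [n] := ubnP (size (p v)); elim: n v => // n IH v.
case: (fp v) => [e|[u _ e]]; rewrite e // => sn.
by rewrite cons_uniq forest_parent_fresh // IH.
Qed.

Lemma forest_path v : path g v (behead (p v)).
Proof.
have [n] := ubnP (size (p v)); elim: n v => // n IH v.
case: (fp v) => [e|[u vu e]]; rewrite e //= => sn.
by have := IH u sn; have [s ->] := forest_head u; rewrite /= vu.
Qed.

End Forest.

(* A forest maximizing the total depth is a depth-first forest. *)
Lemma exists_depth_first : exists2 p, forest p &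
  forall u v, g u v -> v \in p u \/ u \in p v.
Proof.
pose P n := `[< exists2 p, forest p & \sum_v size (p v) = n >].
have exP : exists n, P n.
  by exists (\sum_(v : V) 1); apply/asboolP; exists (fun v => [:: v]) => // v; left.
have bdP n : P n -> n <= \sum_(v : V) #|V|.
  case/asboolP=> p fp <-; apply: leq_sum => v _.
  by have /card_uniqP <- := forest_uniq fp v; apply: max_card.
case: (ex_maxnP exP bdP) => n /asboolP[p fp sp] mx; exists p => //.
suff main u v : g u v -> v \notin p u -> u \notin p v -> size (p v) <= size (p u) -> False.
  move=> u v uv; have [|vu] := boolP (v \in p u); first by left.
  have [|uv'] := boolP (u \in p v); first by right.
  case: (leqP (size (p v)) (size (p u))) => [|/ltnW] le; case: (main _ _ _ _ _ le) => //.
  by rewrite gS.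
move=> uv vu uv' le.
(* The subtree of [v] is hung below [u]. As [v] was no deeper than [u], no path to a root gets
   shorter, and that of [v] gets longer. *)
pose p' w := if v \in p w then take (index v (p w)) (p w) ++ v :: p u else p w.
have p'u : p' u = p u by rewrite /p' (negPf vu).
have [sv ev] := forest_head fp v.
have p'v : p' v = v :: p u by rewrite /p' ev mem_head /= eqxx.
have fp' : forest p'.
  move=> w; have [->|wv] := eqVneq w v; first by right; exists u; rewrite ?p'u // gS.
  case: (fp w) => [e|[x wx e]].
    by left; rewrite /p' e inE eq_sym (negPf wv).
  right; exists x => //; rewrite /p' e inE eq_sym (negPf wv) /=.
  by case: ifP => // _; rewrite (negPf wv).
have szp' w : size (p w) + (w == v) <= size (p' w).
  have [->|wv] := eqVneq w v; first by rewrite p'v /= addn1 ltnS.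
  rewrite addn0 /p'; case: ifP => // vw; have [s es] := forest_suffix fp vw.
  have : index v (p w) = size s.
    rewrite es index_cat ev /= eqxx addn0; case: ifP => // vs.
    by have := forest_uniq fp w; rewrite es cat_uniq => /and3P[_ /hasP[]]; exists v; rewrite // ev mem_head.
  move=> ->; rewrite es take_size_cat // !size_cat leq_add2l /=.
  exact: leqW.
have : P (\sum_w size (p' w)) by apply/asboolP; exists p'.
move/mx; rewrite leqNgt => /negP[]; rewrite -sp -addn1.
have -> : 1 = \sum_w (w == v : nat) by rewrite -big_mkcond /= big_pred1_eq.
by rewrite -big_split /=; apply: leq_sum => w _; apply: szp'.
Qed.

End DepthFirstForest.

(** The bag of [v] is [X] with the first [l] vertices on the path from [v] to its root; an extra
    root [None] with bag [X] joins the trees. An edge outside [X] joins a vertex to an ancestor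
    fewer than [l] steps up: otherwise it would close, with the tree path, a cycle of more than [l]
    vertices avoiding [X]. *)
Lemma treewidth_le (G : sgraph) (X : {set G}) l : 1 < l ->
  (forall c, is_cyc (@adj G) c -> {in c, forall x, x \notin X} -> size c < l) ->
  treewidth G <= #|X| + l.
Proof.
move=> l1 short.
pose g' x y := [&& adj x y, x \notin X & y \notin X].
have g'S : symmetric g'.
  by move=> x y; rewrite /g' adj_sym; congr (_ && _); apply: andbC.
have g'I : irreflexive g' by move=> x; rewrite /g' adj_irrefl.
have [p fp dfs] := exists_depth_first g'S.
pose par (a : option G) := obind (fun v => ohead (behead (p v))) a.
pose rank (a : option G) := if a is Some v then size (p v) else 0.
have parS v : p v = [:: v] /\ par (Some v) = None \/
    exists u, [/\ g' v u, p v = v :: p u & par (Some v) = Some u].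
  rewrite /par /=; case: (fp v) => [->|[u vu ->]]; [by left|right; exists u].
  by split=> //=; have [s ->] := forest_head fp u.
have rank_par a : a != None -> rank (par a) < rank a.
  case: a => // v _; case: (parS v) => [[e ->]|[u [_ e ->]]]; rewrite /= e //.
pose T := par_graph par.
pose B (a : T) : {set G} := if a is Some v then X :|: [set x in take l (p v)] else X.
have XB u a : u \in X -> u \in B a by case: a => //= v uX; rewrite inE uX.
have dec : is_tree_decomposition B.
  split.
  - exact: (par_tree (erefl None) rank_par).
  - move=> v; exists (Some v); rewrite /= !inE; have [s ->] := forest_head fp v.
    by case: (l) l1 => // l' _; rewrite mem_head orbT.
  - move=> u v uv; have [uX|uX] := boolP (u \in X).
      exists (Some v); rewrite XB //= !inE; have [s ->] := forest_head fp v.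
      by case: (l) l1 => // l' _; rewrite mem_head orbT.
    have [vX|vX] := boolP (v \in X).
      exists (Some u); rewrite [X in _ && X]XB // andbT /= !inE; have [s ->] := forest_head fp u.
      by case: (l) l1 => // l' _; rewrite mem_head orbT.
    have main x y : g' x y -> y \in p x -> (x \in B (Some x)) && (y \in B (Some x)).
      move=> xy yx; rewrite /= !inE; apply/andP; split; apply/orP; right.
        have [s ->] := forest_head fp x.
        by case: (l) l1 => // l' _; rewrite mem_head.
      rewrite in_take // ltnNge; apply/negP=> ld.
      have [s es] := forest_head fp x; set d := index y (p x) in ld.
      have ds : d < (size s).+1 by rewrite -[X in _ < X]/(size (x :: s)) -es index_mem.
      have ps : path g' x (take d s).
        by have := forest_path fp x; rewrite es /= -{1}(cat_take_drop d s) cat_path => /andP[].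
      have last_y : last x (take d s) = y.
        have := nth_index x yx; rewrite -/d es.
        have -> : last x (take d s) = nth x (take d.+1 (x :: s)) d.
          by have := nth_last x (x :: take d s); rewrite /= size_takel // => <-.
        by rewrite nth_take.
      have ucyc : uniq (x :: take d s).
        by have := take_uniq d.+1 (forest_uniq fp x); rewrite es.
      have cc : is_cyc (@adj G) (x :: take d s).
        rewrite /is_cyc ucyc /= size_takel // ltnS (leq_trans l1 ld) andbT rcons_path last_y.
        rewrite (sub_path _ ps) => [|a b /and3P[]//]; rewrite adj_sym.
        by case/and3P: xy.
      have := short _ cc; rewrite /= size_takel // ltnNge (leqW ld) => H.
      suff : false by []; apply: H => z; rewrite inE => /orP[/eqP->|]; first by case/and3P: xy.
      have pX r : forall a, path g' a r -> z \in r -> z \notin X.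
        by elim: r => //= b r IH a /andP[/and3P[_ _ bX] pr]; rewrite inE => /orP[/eqP->|]; [by []|apply: IH pr].
      exact: pX ps.
    have g'uv : g' u v by rewrite /g' uv uX.
    case: (dfs u v g'uv) => h; first by exists (Some u); apply: main.
    by exists (Some v); rewrite andbC; apply: main; rewrite // g'S.
  - move=> v; have [vX|vX] := boolP (v \in X).
      apply: (par_connected rank_par (top := None)); first by rewrite inE XB.
      by move=> a _ aN; split; rewrite // inE XB.
    apply: (par_connected rank_par (top := Some v)).
      rewrite !inE; have [s ->] := forest_head fp v.
      by case: (l) l1 => // l' _; rewrite mem_head orbT.
    (* A vertex [v] other than [w] comes one place earlier on the path of the parent of [w], so it
       stays among the first [l]. *)
    move=> [w|]; rewrite !inE ?(negPf vX) //= => vw wv; split=> //.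
    case: (parS w) => [[e _]|[u [_ e pu]]].
      by move: (mem_take vw) wv; rewrite e inE => /eqP->; rewrite eqxx.
    rewrite -[ohead _]/(par (Some w)) pu inE; apply/orP; right; rewrite inE.
    move: vw; rewrite e; case: (l) => // l'; rewrite /= inE => /orP[/eqP vw|vu].
      by rewrite vw eqxx in wv.
    by rewrite in_take ?(mem_take vu) // ltnW // ltnS -in_take ?(mem_take vu).
rewrite /treewidth; case: ex_minnP => w _ /(_ (width B)).
have -> : `[< has_decomposition_of_width G (width B) >].
  by apply/asboolP; exists T, B.
move=> /(_ isT) le; apply: leq_trans le _.
rewrite /width; apply: leq_trans (leq_pred _) _.
apply/bigmax_leqP=> -[v|] _ /=; last exact: leq_addr.
rewrite cardsU; apply: leq_trans (leq_subr _ _) _; rewrite leq_add2l.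
rewrite cardsE; apply: leq_trans (card_size _) _.
by rewrite size_take_min geq_minl.
Qed.

(** * Cycle minors and the numerical bound *)

Lemma is_cyc_nth (V : finType) (e : rel V) c x0 : is_cyc e c ->
  (forall a, a.+1 < size c -> e (nth x0 c a) (nth x0 c a.+1)) /\
  e (nth x0 c (size c).-1) (nth x0 c 0).
Proof.
case/and3P; case: c => //= x s _; rewrite rcons_path => /andP[/(pathP x0) ps xs] _.
by split=> [a|]; [apply: ps|rewrite -[size s]/(size (x :: s)).-1 nth_last].
Qed.

Section CycleBranchSets.
Variables (G : sgraph) (c : seq G) (n : nat).
Hypotheses (cc : is_cyc (@adj G) c) (n3 : 2 < n) (nc : n <= size c).

(* The last branch set absorbs the vertices in excess. *)
Definition cycle_branch j : {set G} := [set x in c | minn (index x c) n.-1 == j].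

Lemma cycle_branch_nth x0 a : a < size c -> nth x0 c a \in cycle_branch (minn a n.-1).
Proof. by move=> ac; case/and3P: cc => _ _ uc; rewrite inE mem_nth //= index_uniq. Qed.

Lemma cycle_branch_neq0 j : j < n -> cycle_branch j != set0.
Proof.
move=> jn; have [x0 _] : exists x0 : G, true by case: (c) cc => // x s _; exists x.
apply/set0Pn; exists (nth x0 c j).
have := cycle_branch_nth x0 (leq_trans jn nc).
by rewrite (minn_idPl _) //; move: jn n3; clear; lia.
Qed.

Lemma cycle_branch_connected j : connected_in (cycle_branch j).
Proof.
move=> x y; rewrite !inE => /andP[xc /eqP xj] /andP[yc /eqP yj].
set r := [rel u v in _ | _].
have [x0 _] : exists x0 : G, true by exists x.
have [jn|jn] := ltnP j n.-1.
  have -> : y = x; last exact: connect0.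
  rewrite -(nth_index x0 xc) -(nth_index x0 yc); congr nth.
  by move: xj yj jn; rewrite /minn; do 2 case: ifP; clear; lia.
have rS : connect_sym r.
  by apply: sym_connect_sym => a b; rewrite /= adj_sym [(a \in _) && _]andbC.
have in_br a : n.-1 <= a -> a < size c -> nth x0 c a \in cycle_branch j.
  move=> na ac; have := cycle_branch_nth x0 ac; rewrite (minn_idPr na).
  by have -> : n.-1 = j by move: xj jn; rewrite /minn; case: ifP; clear; lia.
have reach a : n.-1 <= a -> a < size c -> connect r (nth x0 c n.-1) (nth x0 c a).
  elim: a => [|a IH] na ac; first by move: na n3; clear; lia.
  have [e|lt] := eqVneq n.-1 a.+1; first by rewrite e; apply: connect0.
  have na' : n.-1 <= a by move: na lt; clear; lia.
  apply: connect_trans (IH na' (ltnW ac)) _; apply: connect1.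
  rewrite /r /= !in_br //; last exact: ltnW.
  by have [H _] := is_cyc_nth x0 cc; apply: H.
have idx z : z \in c -> minn (index z c) n.-1 = j -> connect r (nth x0 c n.-1) z.
  move=> zc zj; rewrite -{1}(nth_index x0 zc); apply: reach; rewrite ?index_mem //.
  by move: zj jn; rewrite /minn; case: ifP; clear; lia.
by apply: (@connect_trans _ _ (nth x0 c n.-1)); [rewrite rS; apply: idx|apply: idx].
Qed.

Lemma cycle_branch_adj (i j : 'I_n) : cycle_adj i j ->
  exists x y, [/\ x \in cycle_branch i, y \in cycle_branch j & adj x y].
Proof.
have [x0 _] : exists x0 : G, true by case: (c) cc => // x s _; exists x.
have [H1 H2] := is_cyc_nth x0 cc.
have succ (a : 'I_n) : exists x y,
    [/\ x \in cycle_branch a, y \in cycle_branch (ordS a) & adj x y].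
  rewrite /=; have [lt|ge] := ltnP a.+1 n.
    rewrite modn_small //; exists (nth x0 c a), (nth x0 c a.+1).
    have := cycle_branch_nth x0 (leq_trans (ltn_ord a) nc).
    have := cycle_branch_nth x0 (leq_trans lt nc).
    have -> : minn a n.-1 = a by move: (ltn_ord a); clear; lia.
    have -> : minn a.+1 n.-1 = a.+1 by move: lt; clear; lia.
    by split=> //; apply: H1; apply: leq_trans lt nc.
  have ea : a.+1 = n by apply/eqP; rewrite eqn_leq ltn_ord.
  rewrite ea modnn; exists (nth x0 c (size c).-1), (nth x0 c 0).
  have c0 : 0 < size c by move: n3 nc; clear; lia.
  have lc : (size c).-1 < size c by move: c0; clear; lia.
  have := cycle_branch_nth x0 c0; have := cycle_branch_nth x0 lc.
  have -> : minn (size c).-1 n.-1 = a by move: ea nc; clear; lia.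
  by rewrite min0n; split.
case/andP=> _ /orP[]/eqP->; first exact: succ.
by have [x [y [xb yb xy]]] := succ j; exists y, x; rewrite adj_sym.
Qed.

End CycleBranchSets.

Lemma minor_of_cycle_family k (l : 'I_k -> nat) (G H : sgraph) f :
  (forall i, 2 < l i) -> cycle_family l (@adj G) setT f ->
  sgraph_iso H (dunion (fun i => cycle_graph (l i))) -> minor H G.
Proof.
move=> l3 [fc fd] [F [[F' FK F'K] Fadj]].
have {}fc i := fc i (in_setT i).
exists (fun v => cycle_branch (f (tag (F v))) (l (tag (F v))) (tagged (F v) : 'I_(l (tag (F v))))).
split.
- by move=> v; apply: cycle_branch_neq0; rewrite ?ltn_ord //; case: (fc (tag (F v))).
- by move=> v; apply: cycle_branch_connected; case: (fc (tag (F v))).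
- move=> u v uv; have {uv} : F u != F v by apply: contra uv => /eqP/(can_inj FK)/eqP.
  case: (F u) (F v) => [i a] [j b] /= ab; rewrite disjoint_subset; apply/subsetP=> x.
  rewrite !inE => /andP[xi /eqP xa]; apply/negP=> /andP[xj /eqP xb].
  have ij : i = j.
    apply/eqP; apply: contraT => ij; have /hasP[] := fd i j (in_setT i) (in_setT j) ij.
    by exists x.
  move: ij b xb ab xj => <- b xb ab _.
  by case/eqP: ab; congr Tagged; apply: val_inj; rewrite -[LHS]xa -[RHS]xb.
- move=> u v; rewrite -Fadj; case: (F u) (F v) => [i a] [j b] /= /andP[/eqP /= ij].
  move: ij b => <- b; rewrite tagged_asE => ab.
  by apply: cycle_branch_adj; case: (fc i).
Qed.

Lemma card_cycles k (l : 'I_k -> nat) (H : sgraph) :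
  sgraph_iso H (dunion (fun i => cycle_graph (l i))) -> #|H| = \sum_(i in setT) l i.
Proof.
case=> F [/bij_eq_card-> _]; rewrite card_tagged sumnE big_map big_enum /=.
by apply: eq_big => [i|i _]; rewrite ?inE // card_ord.
Qed.

(** [2 ^ t] has to beat [k t] and not only [k], which is why [log log k] enters. With
    [b = up_log 2 a] the right side is [12 * 2 ^ a * 2 ^ b >= 12 k a], and for [a >= 2] the left
    side is at most [8 (k - 1) a + 6 k <= 11 k a]. *)
Lemma log_margin k (a := up_log 2 k) (t := a + up_log 2 a + 3) : 0 < k ->
  2 * (k.-1 * t.*2.-1) + 6 < 3 * 2 ^ t.-1.
Proof.
have ka : k <= 2 ^ a by apply: up_logP.
rewrite {}/t => k0; clearbody a; set b := up_log 2 a.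
have ab : a <= 2 ^ b by apply: up_logP.
have ba : b <= a.-1.
  have [a0|a0] := posnP a; first by rewrite /b a0 up_log0.
  apply: up_log_min => //; move: a0; clear; case: a => // m _ /=.
  by elim: m => // m IH; rewrite expnS; move: IH; lia.
have -> : (a + b + 3).-1 = a + b + 2 by lia.
have -> : (a + b + 3).*2.-1 = 2 * a + 2 * b + 5 by lia.
rewrite !expnD.
have [a0|[a1|a2]] : a = 0 \/ a = 1 \/ 2 <= a by lia.
- have k1 : k = 1 by move: ka k0; rewrite a0; clear; lia.
  by rewrite k1 a0 (_ : b = 0) //; rewrite /b a0 up_log0.
- have b0 : b = 0 by rewrite /b a1 up_log1.
  by move: ka; rewrite a1 b0; clear; case: k => [|[|[|]]].
have h : k * a <= 2 ^ a * 2 ^ b by apply: leq_mul.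
apply: (@leq_trans (12 * (k * a))); last by move: h; clear; lia.
have h1 : k.-1 * (2 * a + 2 * b + 5) <= k.-1 * (4 * a + 3).
  by rewrite leq_mul2l; apply/orP; right; move: ba a2; clear; lia.
have h2 : k * 2 <= k * a by rewrite leq_mul2l a2 orbT.
move: h1 h2 k0 a2; clear; case: k => // k' /=.
have -> : k' * (4 * a + 3) = 4 * (k' * a) + 3 * k' by rewrite mulnDr mulnCA (mulnC k' 3).
rewrite !mulSn; move: (k' * (_ + _)) (k' * a); clear; lia.
Qed.

Lemma treewidth_nat_bound k (l : 'I_k -> nat) (G H : sgraph)
    (a := up_log 2 k) (t := a + up_log 2 a + 3) : 0 < k -> (forall i, 2 < l i) ->
  sgraph_iso H (dunion (fun i => cycle_graph (l i))) -> ~ minor H G ->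
  treewidth G <= #|H|.*2 + 5 * (k.-1 * t.*2.-1) + k.*2.
Proof.
move=> k0 l3 iso nm.
have kN : k <= k.-1.+1 by rewrite prednK.
have t0 : 0 < t by rewrite /t addn3.
have [[f fP]|[X [m [m3 Xm Xs]]]] :=
  cycle_family_or_hitting_set l3 t0 kN (log_margin k0) setT (@adj_sym G) (@adj_irrefl G).
  by case: nm; apply: minor_of_cycle_family l3 fP iso.
apply: leq_trans (treewidth_le (ltnW m3) Xm) _.
by rewrite (card_cycles iso); move: Xs; rewrite cardsT card_ord.
Qed.

Import Order.TTheory GRing.Theory Num.Theory.
Local Open Scope ring_scope.

Lemma log2_ge (R : realType) m (x : R) : 2 ^+ m <= x -> m%:R <= log2 x.
Proof.
move=> mx; have ln2 : 0 < ln 2 :> R by rewrite ln_gt0 // ltr1n.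
rewrite /log2 ler_pdivlMr // mulr_natl -lnXn // ler_ln ?posrE ?exprn_gt0 //.
by apply: lt_le_trans mx; apply: exprn_gt0.
Qed.

(** Each of the two rounded logarithms exceeds the true one by at most 1. *)
Lemma nat_bound_le (R : realType) k n (a := up_log 2 k) (t := (a + up_log 2 a + 3)%N) :
  (0 < k)%N -> (3 * k <= n)%N ->
  (n.*2 + 5 * (k.-1 * t.*2.-1) + k.*2)%:R <=
  6 * n%:R + 10 * k%:R * log2 k%:R
  + (if k == 1%N then 0 else 10 * k%:R * log2 (log2 k%:R)) + 40 * k%:R :> R.
Proof.
move=> k0 kn; have [k1|k1] := eqVneq k 1%N.
  rewrite k1 /= /log2 ln1 mul0r mulr0 !addr0.
  by rewrite -(natrM _ 6) -natrM -natrD ler_nat; lia.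
have k2 : (1 < k)%N by rewrite ltn_neqAle eq_sym k1.
set L := log2 k%:R; set b := up_log 2 a in t *.
have a0 : (0 < a)%N by rewrite up_log_gt0.
have aL : a%:R <= L + 1.
  have : (a.-1)%:R <= L by apply: log2_ge; rewrite -natrX ler_nat ltnW // up_log_gtn.
  by rewrite -{2}(prednK a0) -natr1; lra.
have L1 : 1 <= L by apply: (log2_ge (m := 1)); rewrite expr1 ler_nat.
have bL : b%:R <= log2 L + 1.
  have [b0|b0] := posnP b.
    have : 0 <= log2 L by apply: (log2_ge (m := 0)); rewrite expr0.
    by rewrite b0; lra.
  have a1 : (1 < a)%N by move: b0; rewrite up_log_gt0.
  have : (b.-1)%:R <= log2 L.
    apply: log2_ge; have : (2 ^ b.-1 < a)%N by apply: up_log_gtn.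
    rewrite -natrX -(prednK a0) ltnS -(ler_nat R) => /le_trans; apply.
    by rewrite -(lerD2r 1) natr1 prednK.
  by rewrite -{2}(prednK b0) -natr1; lra.
apply: (@le_trans _ _ ((n.*2 + 5 * (k * (2 * (a + b) + 5)) + k.*2)%:R)).
  have -> : t.*2.-1 = (2 * (a + b) + 5)%N by rewrite /t; lia.
  by rewrite ler_nat !leq_add2r leq_add2l !leq_mul // leq_pred.
have kn' : 3 * k%:R <= n%:R :> R by rewrite -natrM ler_nat.
have ab : (k%:R : R) * (a%:R + b%:R) <= k%:R * (L + 1 + (log2 L + 1)).
  by rewrite ler_wpM2l // lerD.
rewrite -!mul2n !(natrD, natrM).
(* The terms linear in [k] on the left add up to [20 + 25 + 2 = 47]; on the right there are 40, and
   [4 n >= 12 k] covers the rest. *)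
have := ler0n R k; lra.
Qed.

Theorem theorem1 (R : realType) (k : nat) (H : sgraph)
    (k_ge1 : (1 <= k)%N) (H_cycles : is_disjoint_union_of_cycles k H) :
  (forall G : sgraph, ~ minor H G -> (treewidth G)%:R <= cycles_bound R k H) /\
  (exists n : nat, is_f H n /\ n%:R <= cycles_bound R k H).
Proof.
have [l [l3 iso]] := H_cycles.
pose a := up_log 2 k; pose t := (a + up_log 2 a + 3)%N.
pose m := (#|H|.*2 + 5 * (k.-1 * t.*2.-1) + k.*2)%N.
have tw_m G : ~ minor H G -> (treewidth G <= m)%N by apply: treewidth_nat_bound.
have m_le : m%:R <= cycles_bound R k H.
  apply: nat_bound_le => //.
  rewrite (card_cycles iso) mulnC -[X in (X * 3)%N](card_ord k) -cardsT -sum_nat_const.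
  by apply: leq_sum.
split=> [G nm|]; first by apply: le_trans m_le; rewrite ler_nat; apply: tw_m.
(* The bound [m] shows that some bound exists, so a least one does and [f(H)] is defined. *)
have exP : exists n, `[< is_minor_treewidth_bound H n >].
  by exists m; apply/asboolP=> G; apply: tw_m.
case: (ex_minnP exP) => n /asboolP nP nmin; exists n; split.
  by split=> // n' n'P; apply: nmin; apply/asboolP.
by apply: le_trans m_le; rewrite ler_nat; apply: nmin; apply/asboolP=> G; apply: tw_m.
Qed.
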